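(* Let $\mathcal A$ be a unital C$^*$-algebra and $x_1,\ldots,x_n$ self-adjoint elements of $\mathcal A$. Then $\delta_{top}(x_1,\ldots,x_n)\le\max\{\mathfrak K_{top}^{(2)}(x_1,\ldots,x_n),1\}$. In particular, if $\mathfrak K_{top}^{(2)}(x_1,\ldots,x_n)=0$ then $\delta_{top}(x_1,\ldots,x_n)\le1$.
   Context: Microstates. Let $\mathcal A$ be a unital C$^*$-algebra and $x_1,\dots,x_n,y_1,\dots,y_m$ self-adjoint elements of $\mathcal A$. Let $\{P_r\}_{r\ge1}$ enumerate all noncommutative polynomials in the indeterminates $X_1,\dots,X_n,Y_1,\dots,Y_m$ whose coefficients have rational real and imaginary parts (constants allowed). $\mathcal M_k^{s.a.}(\mathbb C)$ is the set of self-adjoint $k\times k$ complex matrices and $\tau_k=\frac1k\mathrm{Tr}$. For $R,\epsilon>0$ and $r,k\in\mathbb N$, $\Gamma_R^{(top)}(x_1,\dots,x_n:y_1,\dots,y_m;k,\epsilon,P_1,\dots,P_r)$ is the set of $(A_1,\dots,A_n)\in\mathcal M_k^{s.a.}(\mathbb C)^n$ for which there exist $B_1,\dots,B_m\in\mathcal M_k^{s.a.}(\mathbb C)$ with $\max_{i,j}\{\|A_i\|,\|B_j\|\}\le R$ and $\big|\|P_j(A_1,\dots,A_n,B_1,\dots,B_m)\|-\|P_j(x_1,\dots,x_n,y_1,\dots,y_m)\|\big|\le\epsilon$ for $1\le j\le r$. When $m=0$ it is written $\Gamma_R^{(top)}(x_1,\dots,x_n;k,\epsilon,P_1,\dots,P_r)$.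 Covering numbers. On $\mathcal M_k(\mathbb C)^n$ put $\|(A_i)\|=\max_i\|A_i\|$ (operator norm) and $\|(A_i)\|_2=(\sum_i\tau_k(A_i^*A_i))^{1/2}$. For $\Sigma\subseteq\mathcal M_k(\mathbb C)^n$, $\nu_\infty(\Sigma,\omega)$ is the minimal number of open $\|\cdot\|$-balls of radius $\omega$ centred at points of $\Sigma$ covering $\Sigma$. The $\omega$-orbit ball centred at $(B_i)$ is the set of $(A_i)$ such that some unitary $W\in\mathcal M_k(\mathbb C)$ satisfies $\|(A_i)-(WB_iW^* )\|_2<\omega$; $o_2(\Sigma,\omega)$ is the minimal number of $\omega$-orbit balls centred at points of $\Sigma$ covering $\Sigma$. Convention $\log 0=-\infty$. Topological free entropy dimension: $\delta_{top}(x:y)=\limsup_{\omega\to0^+}\sup_{R>0}\inf_{\epsilon>0,r\in\mathbb N}\limsup_{k\to\infty}\frac{\log\nu_\infty(\Gamma_R^{(top)}(x:y;k,\epsilon,P_1,\dots,P_r),\omega)}{-k^2\log\omega}$. Topological orbit dimension: $\mathfrak K^{(2)}_{top}(x:y;\omega)=\sup_{R>0}\inf_{\epsilon>0,r\in\mathbb N}\limsup_{k\to\infty}\frac{\log o_2(\Gamma_R^{(top)}(x:y;k,\epsilon,P_1,\dots,P_r),\omega)}{k^2}$ and $\mathfrak K_{top}^{(2)}(x:y)=\limsup_{\omega\to0^+}\mathfrak K_{top}^{(2)}(x:y;\omega)$. When $m=0$ the ''$:y$'' part is omitted. *)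

(* Defs.v *)
From Stdlib Require Import Reals QArith Qreals List Classical ClassicalEpsilon.
Open Scope R_scope.

Record C := mkC { CRe : R; CIm : R }.
Definition C0 : C := mkC 0 0.
Definition C1 : C := mkC 1 0.
Definition Cadd (z w : C) : C := mkC (CRe z + CRe w) (CIm z + CIm w).
Definition Copp (z : C) : C := mkC (- CRe z) (- CIm z).
Definition Cmul (z w : C) : C :=
  mkC (CRe z * CRe w - CIm z * CIm w) (CRe z * CIm w + CIm z * CRe w).
Definition Cconj (z : C) : C := mkC (CRe z) (- CIm z).
Definition Cmod (z : C) : R := sqrt (CRe z ^ 2 + CIm z ^ 2).
Definition Q2C (a b : Q) : C := mkC (Q2R a) (Q2R b).

Record CStarAlgebra := {
  car :> Type;
  c0 : car; c1 : car;
  cadd : car -> car -> car;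
  copp : car -> car;
  cmul : car -> car -> car;
  csmul : C -> car -> car;
  cstar : car -> car;
  cnorm : car -> R;
  cadd_assoc : forall a b c, cadd a (cadd b c) = cadd (cadd a b) c;
  cadd_comm : forall a b, cadd a b = cadd b a;
  cadd_0 : forall a, cadd c0 a = a;
  cadd_opp : forall a, cadd a (copp a) = c0;
  csmul_assoc : forall s t a, csmul s (csmul t a) = csmul (Cmul s t) a;
  csmul_1 : forall a, csmul C1 a = a;
  csmul_addr : forall s a b, csmul s (cadd a b) = cadd (csmul s a) (csmul s b);
  csmul_addl : forall s t a, csmul (Cadd s t) a = cadd (csmul s a) (csmul t a);
  cmul_assoc : forall a b c, cmul a (cmul b c) = cmul (cmul a b) c;
  cmul_1l : forall a, cmul c1 a = a;
  cmul_1r : forall a, cmul a c1 = a;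
  cmul_addl : forall a b c, cmul (cadd a b) c = cadd (cmul a c) (cmul b c);
  cmul_addr : forall a b c, cmul a (cadd b c) = cadd (cmul a b) (cmul a c);
  cmul_smull : forall s a b, cmul (csmul s a) b = csmul s (cmul a b);
  cmul_smulr : forall s a b, cmul a (csmul s b) = csmul s (cmul a b);
  cstar_invol : forall a, cstar (cstar a) = a;
  cstar_add : forall a b, cstar (cadd a b) = cadd (cstar a) (cstar b);
  cstar_smul : forall s a, cstar (csmul s a) = csmul (Cconj s) (cstar a);
  cstar_mul : forall a b, cstar (cmul a b) = cmul (cstar b) (cstar a);
  cnorm_nonneg : forall a, 0 <= cnorm a;
  cnorm_eq0 : forall a, cnorm a = 0 -> a = c0;
  cnorm_smul : forall s a, cnorm (csmul s a) = Cmod s * cnorm a;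
  cnorm_triangle : forall a b, cnorm (cadd a b) <= cnorm a + cnorm b;
  cnorm_submult : forall a b, cnorm (cmul a b) <= cnorm a * cnorm b;
  cnorm_cstar : forall a, cnorm (cmul (cstar a) a) = cnorm a ^ 2;
  ccomplete : forall u : nat -> car,
    (forall e, 0 < e -> exists N, forall p q, (N <= p)%nat -> (N <= q)%nat ->
        cnorm (cadd (u p) (copp (u q))) < e) ->
    exists l, forall e, 0 < e -> exists N, forall p, (N <= p)%nat ->
        cnorm (cadd (u p) (copp l)) < e
}.

Inductive ncpoly :=
| NCconst (a b : Q)          (* the constant a + i b *)
| NCvar (i : nat)
| NCadd (p q : ncpoly)
| NCmul (p q : ncpoly).

Fixpoint vars_lt (n : nat) (p : ncpoly) : Prop :=
  match p with
  | NCconst _ _ => True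
  | NCvar i => (i < n)%nat
  | NCadd p q => vars_lt n p /\ vars_lt n q
  | NCmul p q => vars_lt n p /\ vars_lt n q
  end.

Fixpoint aeval (A : CStarAlgebra) (x : nat -> A) (p : ncpoly) : A :=
  match p with
  | NCconst a b => csmul A (Q2C a b) (c1 A)
  | NCvar i => x i
  | NCadd p q => cadd A (aeval A x p) (aeval A x q)
  | NCmul p q => cmul A (aeval A x p) (aeval A x q)
  end.

Fixpoint rsum (k : nat) (f : nat -> R) : R :=
  match k with O => 0 | S k' => rsum k' f + f k' end.
Fixpoint csum (k : nat) (f : nat -> C) : C :=
  match k with O => C0 | S k' => Cadd (csum k' f) (f k') end.
Fixpoint rmaxn (k : nat) (f : nat -> R) : R :=
  match k with O => 0 | S k' => Rmax (rmaxn k' f) (f k') end.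

(* supremum of a set of reals (meaningful when it is bounded, nonempty) *)
Definition Rsup (E : R -> Prop) : R := epsilon (inhabits 0) (is_lub E).

(* k x k complex matrices, represented as functions supported on        *)
(* indices < k                                                          *)
Definition Mat := nat -> nat -> C.
Definition Vec := nat -> C.

Definition mat_supp (k : nat) (M : Mat) : Prop :=
  forall i j, (k <= i)%nat \/ (k <= j)%nat -> M i j = C0.
Definition mat_eqk (k : nat) (M N : Mat) : Prop :=
  forall i j, (i < k)%nat -> (j < k)%nat -> M i j = N i j.
Definition mat_adj (M : Mat) : Mat := fun i j => Cconj (M j i).
Definition mat_sa (k : nat) (M : Mat) : Prop := mat_eqk k M (mat_adj M).
Definition mat_add (M N : Mat) : Mat := fun i j => Cadd (M i j) (N i j).
Definition mat_sub (M N : Mat) : Mat := fun i j => Cadd (M i j) (Copp (N i j)).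
Definition mat_mul (k : nat) (M N : Mat) : Mat :=
  fun i j => csum k (fun l => Cmul (M i l) (N l j)).
Definition mat_scal (k : nat) (c : C) : Mat :=
  fun i j => if (Nat.ltb i k && Nat.eqb i j)%bool then c else C0.
Definition mat_vec (k : nat) (M : Mat) (v : Vec) : Vec :=
  fun i => csum k (fun j => Cmul (M i j) (v j)).
Definition vnorm (k : nat) (v : Vec) : R := sqrt (rsum k (fun i => Cmod (v i) ^ 2)).
Definition op_norm (k : nat) (M : Mat) : R :=
  Rsup (fun r => exists v, vnorm k v <= 1 /\ r = vnorm k (mat_vec k M v)).
Definition tau (k : nat) (M : Mat) : C :=
  mkC (rsum k (fun i => CRe (M i i)) / INR k) (rsum k (fun i => CIm (M i i)) / INR k).
Definition unitary (k : nat) (W : Mat) : Prop :=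
  mat_supp k W /\ mat_eqk k (mat_mul k W (mat_adj W)) (mat_scal k C1)
  /\ mat_eqk k (mat_mul k (mat_adj W) W) (mat_scal k C1).

Fixpoint meval (k : nat) (A : nat -> Mat) (p : ncpoly) : Mat :=
  match p with
  | NCconst a b => mat_scal k (Q2C a b)
  | NCvar i => A i
  | NCadd p q => mat_add (meval k A p) (meval k A q)
  | NCmul p q => mat_mul k (meval k A p) (meval k A q)
  end.

(* n-tuples of matrices: indices i < n are meaningful *)
Definition Tup := nat -> Mat.
Definition tup_dist_inf (n k : nat) (A B : Tup) : R :=
  rmaxn n (fun i => op_norm k (mat_sub (A i) (B i))).
Definition tup_dist2 (n k : nat) (A B : Tup) : R :=
  sqrt (rsum n (fun i => let D := mat_sub (A i) (B i) in
                         CRe (tau k (mat_mul k (mat_adj D) D)))).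
Definition tup_conj (k : nat) (W : Mat) (B : Tup) : Tup :=
  fun i => mat_mul k (mat_mul k W (B i)) (mat_adj W).

Inductive Rbar := Finite (r : R) | PInf | MInf.

Definition Rbar_le (x y : Rbar) : Prop :=
  match x, y with
  | MInf, _ => True
  | _, PInf => True
  | Finite a, Finite b => a <= b
  | _, _ => False
  end.

Definition Rbar_is_lub (E : Rbar -> Prop) (l : Rbar) : Prop :=
  (forall z, E z -> Rbar_le z l) /\
  (forall u, (forall z, E z -> Rbar_le z u) -> Rbar_le l u).
Definition Rbar_is_glb (E : Rbar -> Prop) (l : Rbar) : Prop :=
  (forall z, E z -> Rbar_le l z) /\
  (forall u, (forall z, E z -> Rbar_le u z) -> Rbar_le u l).
Definition Rbar_sup (E : Rbar -> Prop) : Rbar := epsilon (inhabits MInf) (Rbar_is_lub E).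
Definition Rbar_inf (E : Rbar -> Prop) : Rbar := epsilon (inhabits MInf) (Rbar_is_glb E).
Definition Rbar_max (x y : Rbar) : Rbar := Rbar_sup (fun z => z = x \/ z = y).

Definition Rbar_ln (x : Rbar) : Rbar :=
  match x with
  | Finite r => if Rlt_dec 0 r then Finite (ln r) else MInf
  | PInf => PInf
  | MInf => MInf
  end.
Definition Rbar_mult_real (x : Rbar) (c : R) : Rbar :=
  match x with
  | Finite r => Finite (r * c)
  | PInf => if Rlt_dec 0 c then PInf else if Rlt_dec c 0 then MInf else Finite 0
  | MInf => if Rlt_dec 0 c then MInf else if Rlt_dec c 0 then PInf else Finite 0
  end.

Definition limsup_seq (u : nat -> Rbar) : Rbar :=
  Rbar_inf (fun y => exists N, y = Rbar_sup (fun z => exists k, (N <= k)%nat /\ z = u k)).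
Definition limsup_0plus (f : R -> Rbar) : Rbar :=
  Rbar_inf (fun y => exists d, 0 < d /\
              y = Rbar_sup (fun z => exists w, 0 < w < d /\ z = f w)).

(* Gamma_R^(top)(x_1..x_n; k, eps, P_1..P_r), with P_{j+1} := P j       *)
Definition Gamma_top (A : CStarAlgebra) (n : nat) (x : nat -> A) (P : nat -> ncpoly)
  (Rr : R) (k : nat) (eps : R) (r : nat) (T : Tup) : Prop :=
  (forall i, (n <= i)%nat -> forall a b, T i a b = C0) /\
  (forall i, (i < n)%nat ->
     mat_supp k (T i) /\ mat_sa k (T i) /\ op_norm k (T i) <= Rr) /\
  (forall j, (j < r)%nat ->
     Rabs (op_norm k (meval k T (P j)) - cnorm A (aeval A x (P j))) <= eps).

(* covering number nu_infty(S, w) (as an extended real; +oo if no finite cover) *)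
Definition nu_inf (n k : nat) (S : Tup -> Prop) (w : R) : Rbar :=
  Rbar_inf (fun y => exists cs : list Tup,
     y = Finite (INR (length cs)) /\ (forall c, In c cs -> S c) /\
     (forall a, S a -> exists c, In c cs /\ tup_dist_inf n k a c < w)).

Definition orbit_ball (n k : nat) (B : Tup) (w : R) (T : Tup) : Prop :=
  exists W, unitary k W /\ tup_dist2 n k T (tup_conj k W B) < w.

Definition o2 (n k : nat) (S : Tup -> Prop) (w : R) : Rbar :=
  Rbar_inf (fun y => exists cs : list Tup,
     y = Finite (INR (length cs)) /\ (forall c, In c cs -> S c) /\
     (forall a, S a -> exists c, In c cs /\ orbit_ball n k c w a)).

Definition inf_eps_r (g : R -> nat -> Rbar) : Rbar :=
  Rbar_inf (fun y => exists eps r, 0 < eps /\ y = g eps r).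
Definition sup_R (g : R -> Rbar) : Rbar :=
  Rbar_sup (fun y => exists Rr, 0 < Rr /\ y = g Rr).

Definition delta_top (A : CStarAlgebra) (n : nat) (x : nat -> A) (P : nat -> ncpoly) : Rbar :=
  limsup_0plus (fun w =>
    sup_R (fun Rr =>
      inf_eps_r (fun eps r =>
        limsup_seq (fun k =>
          Rbar_mult_real
            (Rbar_ln (nu_inf n k (Gamma_top A n x P Rr k eps r) w))
            (/ (- (INR k ^ 2) * ln w)))))).

Definition K2_top_omega (A : CStarAlgebra) (n : nat) (x : nat -> A) (P : nat -> ncpoly)
  (w : R) : Rbar :=
  sup_R (fun Rr =>
    inf_eps_r (fun eps r =>
      limsup_seq (fun k =>
        Rbar_mult_real
          (Rbar_ln (o2 n k (Gamma_top A n x P Rr k eps r) w))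
          (/ (INR k ^ 2))))).

Definition K2_top (A : CStarAlgebra) (n : nat) (x : nat -> A) (P : nat -> ncpoly) : Rbar :=
  limsup_0plus (K2_top_omega A n x P).

(* Main.v *)
(* Write [Gamma] for the microstates.  Covering [Gamma] by [w]-orbit balls and
   the unitary group by [(C/w)^(k^2)] sets of [||.||_2]-diameter [w] cuts
   [Gamma] into pieces of [||.||_2]-diameter [O(w)]; each of these is cut further
   into [C^(k^2)] pieces of operator norm diameter [O(w)].  Hence
   [log nu <= log o2 + k^2 (log C - log w)], and after division by [-k^2 log w]
   the first term and the constants vanish as [w -> 0] when the orbit dimension
   is finite.  All constants are uniform in the cutoff [R], as the norms of the
   generators bound those of the microstates.

   The [||.||_2]-covering estimates count lattice points.  The passage to
   the operator norm rounds a matrix to the lattice [(w/sqrt k) Z^(k^2)] at random: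
   the error has independent centred entries of size [w/sqrt k], hence operator
   norm [O(w)].  The exponent [k^2] for the unitary group comes from a chart
   onto skew-adjoint matrices near each point of a [1/4]-net. *)

Require Import Defs.
From Stdlib Require Import Reals QArith Qreals List Classical ClassicalEpsilon.
From Stdlib Require Import Lra Lia ZArith FunctionalExtensionality.
(* [C0], [C1] are also names of the Stdlib. *)
Import Defs.
Open Scope R_scope.

(** * Euclidean norms, lattice points and rounding *)

(** Lattice counting stands in for volume comparison: an l1 ball of radius N m in Z^N has at most (8
    m)^N integer points, and no Haar or Lebesgue measure enters. The exact exponent matters only
    once. A cut with bounded ratio of radii costs C^(k^2) whatever multiple of k^2 the dimension is,
    so the passage to the operator norm may spend 2 k^2 real parameters per matrix. Only the cut of
    the unitary group has ratio 1/w, and there 2 k^2 parameters would give the bound 2 instead of 1.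
    The chart needs closeness in operator norm, so its 1/4-net is itself obtained from the random
    rounding. Uniformity in the cutoff is essential because the supremum over [R] stands inside the
    limsup over [w]: the threshold for [w] is fixed before [R] is known, whereas [eps], [r] and the
    threshold for [k] may depend on both. *)

Lemma rsum_ext k f g : (forall i, (i < k)%nat -> f i = g i) -> rsum k f = rsum k g.
Proof.
  induction k; simpl; intros H; auto. rewrite IHk, H by auto with arith. reflexivity.
Qed.

Lemma rsum_le k f g : (forall i, (i < k)%nat -> f i <= g i) -> rsum k f <= rsum k g.
Proof.
  induction k; simpl; intros H; [lra|].
  apply Rplus_le_compat; auto with arith.
Qed.

Lemma rsum_plus k f g : rsum k (fun i => f i + g i) = rsum k f + rsum k g.
Proof. induction k; simpl; [lra | rewrite IHk; lra]. Qed.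

Lemma rsum_scal k c f : rsum k (fun i => c * f i) = c * rsum k f.
Proof. induction k; simpl; [lra | rewrite IHk; lra]. Qed.

Lemma rsum_const k c : rsum k (fun _ => c) = INR k * c.
Proof. induction k; [simpl; lra | rewrite S_INR; simpl rsum; rewrite IHk; lra]. Qed.

Lemma rsum_nonneg k f : (forall i, (i < k)%nat -> 0 <= f i) -> 0 <= rsum k f.
Proof.
  intros H. rewrite <- (Rmult_0_r (INR k)), <- rsum_const. apply rsum_le, H.
Qed.

Lemma rsum_term_le k f i : (forall j, (j < k)%nat -> 0 <= f j) -> (i < k)%nat -> f i <= rsum k f.
Proof.
  induction k; simpl; intros H Hi; [lia|].
  assert (0 <= rsum k f) by (apply rsum_nonneg; auto with arith).
  destruct (Nat.eq_dec i k) as [->|]; [lra|].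
  assert (f i <= rsum k f) by (apply IHk; auto with arith; lia).
  specialize (H k (Nat.lt_succ_diag_r k)); lra.
Qed.

Lemma rsum_swap k m (f : nat -> nat -> R) :
  rsum k (fun i => rsum m (f i)) = rsum m (fun j => rsum k (fun i => f i j)).
Proof.
  induction k; simpl.
  - rewrite rsum_const; lra.
  - rewrite IHk, <- rsum_plus. reflexivity.
Qed.

Lemma rsum_add_range k m f :
  rsum (k + m) f = rsum k f + rsum m (fun j => f (k + j)%nat).
Proof.
  induction m; simpl; [rewrite Nat.add_0_r; lra|].
  rewrite Nat.add_succ_r; simpl. rewrite IHm; lra.
Qed.

Lemma rsum_flatten k m f :
  rsum (k * m) f = rsum k (fun i => rsum m (fun j => f (i * m + j)%nat)).
Proof.
  induction k; simpl; auto.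
  rewrite Nat.add_comm, rsum_add_range, IHk. reflexivity.
Qed.

Definition nrm (k : nat) (f : nat -> R) : R := sqrt (rsum k (fun i => f i ^ 2)).

Lemma sumsq_nonneg k f : 0 <= rsum k (fun i => f i ^ 2).
Proof. apply rsum_nonneg; intros; apply pow2_ge_0. Qed.

Lemma nrm_nonneg k f : 0 <= nrm k f.
Proof. apply sqrt_pos. Qed.

Lemma nrm_sq k f : nrm k f ^ 2 = rsum k (fun i => f i ^ 2).
Proof. apply pow2_sqrt, sumsq_nonneg. Qed.

Lemma sq_le_inv a b : 0 <= b -> a ^ 2 <= b ^ 2 -> a <= b.
Proof. intros; nra. Qed.

Lemma nrm_le_of_sq k f c : 0 <= c -> rsum k (fun i => f i ^ 2) <= c ^ 2 -> nrm k f <= c.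
Proof. intros Hc H. apply sq_le_inv; auto. rewrite nrm_sq; auto. Qed.

Lemma rsum_mul_sq_le k f g :
  rsum k (fun i => f i * g i) ^ 2 <= rsum k (fun i => f i ^ 2) * rsum k (fun i => g i ^ 2).
Proof.
  set (a := rsum k (fun i => f i ^ 2)). set (c := rsum k (fun i => g i ^ 2)).
  set (b := rsum k (fun i => f i * g i)).
  assert (Q : forall s t, 0 <= s ^ 2 * a + 2 * (s * t) * b + t ^ 2 * c).
  { intros s t. unfold a, b, c. rewrite <- !rsum_scal, <- !rsum_plus.
    apply rsum_nonneg; intros. replace (_ + _) with ((s * f i + t * g i) ^ 2) by ring.
    apply pow2_ge_0. }
  assert (Ha : 0 <= a) by apply sumsq_nonneg.
  assert (Hc : 0 <= c) by apply sumsq_nonneg.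
  destruct (Rle_lt_or_eq_dec 0 a Ha) as [Ha'|Ha'].
  (* At (b, -a) the form takes the value a (a c - b^2). *)
  - specialize (Q b (- a)). assert (a * (b ^ 2 - a * c) <= 0) by nra. nra.
  - rewrite <- Ha' in *.
    (* With a = 0 the value at (c + 1, -b) is -(c + 2) b^2, which forces b = 0. *)
    generalize (Q (c + 1) (- b)); intro. nra.
Qed.

Lemma cauchy_schwarz k f g : rsum k (fun i => f i * g i) <= nrm k f * nrm k g.
Proof.
  apply sq_le_inv.
  - apply Rmult_le_pos; apply nrm_nonneg.
  - rewrite Rpow_mult_distr, !nrm_sq. apply rsum_mul_sq_le.
Qed.

Lemma nrm_le k f g : (forall i, (i < k)%nat -> 0 <= f i <= g i) -> nrm k f <= nrm k g.
Proof.
  intros H. apply sqrt_le_1_alt, rsum_le. intros i Hi. specialize (H i Hi). nra.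
Qed.

Lemma nrm_ext k f g : (forall i, (i < k)%nat -> f i = g i) -> nrm k f = nrm k g.
Proof. intros H. unfold nrm. f_equal. apply rsum_ext. intros; rewrite H; auto. Qed.

Lemma nrm_triangle k f g : nrm k (fun i => f i + g i) <= nrm k f + nrm k g.
Proof.
  assert (0 <= nrm k f) by apply nrm_nonneg. assert (0 <= nrm k g) by apply nrm_nonneg.
  apply nrm_le_of_sq; [lra|].
  assert (E : rsum k (fun i => (f i + g i) ^ 2)
              = nrm k f ^ 2 + 2 * rsum k (fun i => f i * g i) + nrm k g ^ 2).
  { rewrite !nrm_sq, <- rsum_scal, <- !rsum_plus. apply rsum_ext; intros; ring. }
  rewrite E. generalize (cauchy_schwarz k f g). nra.
Qed.

Lemma nrm_scal k c f : 0 <= c -> nrm k (fun i => c * f i) = c * nrm k f.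
Proof.
  intros Hc. unfold nrm.
  rewrite (rsum_ext k _ (fun i => c ^ 2 * f i ^ 2)) by (intros; ring).
  rewrite rsum_scal, sqrt_mult_alt by apply pow2_ge_0. rewrite sqrt_pow2; auto.
Qed.

Lemma nrm_abs k f : nrm k (fun i => Rabs (f i)) = nrm k f.
Proof. unfold nrm. f_equal. apply rsum_ext. intros; apply pow2_abs. Qed.

Lemma rsum_abs_le k f : rsum k (fun i => Rabs (f i)) <= sqrt (INR k) * nrm k f.
Proof.
  rewrite <- (nrm_abs k f).
  replace (sqrt (INR k)) with (nrm k (fun _ => 1)).
  - rewrite (rsum_ext k _ (fun i => 1 * Rabs (f i))) by (intros; ring). apply cauchy_schwarz.
  - unfold nrm. rewrite rsum_const. f_equal; ring.
Qed.

Definition lsum {X} (l : list X) (f : X -> R) : R := fold_right (fun x s => f x + s) 0 l.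

Lemma lsum_le {X} (l : list X) f g : (forall x, In x l -> f x <= g x) -> lsum l f <= lsum l g.
Proof.
  induction l; simpl; intros H; [lra|]. apply Rplus_le_compat; auto.
Qed.

Lemma lsum_ext {X} (l : list X) f g : (forall x, In x l -> f x = g x) -> lsum l f = lsum l g.
Proof. induction l; simpl; intros H; auto. rewrite H, IHl; auto. Qed.

Lemma lsum_lin {X} (l : list X) f g c d :
  lsum l (fun x => c * f x + d * g x) = c * lsum l f + d * lsum l g.
Proof. induction l; simpl; [ring | rewrite IHl; ring]. Qed.

Lemma lsum_const {X} (l : list X) c : lsum l (fun _ => c) = INR (length l) * c.
Proof. induction l; [simpl; ring|]. simpl length; rewrite S_INR; simpl; rewrite IHl; ring. Qed.

Lemma lsum_term_le {X} (l : list X) f x :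
  (forall y, In y l -> 0 <= f y) -> In x l -> f x <= lsum l f.
Proof.
  induction l; simpl; intros H Hx; [tauto|].
  assert (0 <= lsum l f).
  { rewrite <- (Rmult_0_r (INR (length l))), <- lsum_const. apply lsum_le; auto. }
  assert (0 <= f a) by auto.
  destruct Hx as [->|Hx]; [lra|]. specialize (IHl (fun y Hy => H y (or_intror Hy)) Hx). lra.
Qed.

(** * Counting integer points in l1 balls *)

Definition zupd (z : nat -> Z) (i : nat) (a : Z) : nat -> Z :=
  fun j => if Nat.eqb j i then a else z j.

(** The l1 norm is convenient because its integer budget splits additively over the coordinates;
    Cauchy-Schwarz brings Euclidean balls into this form. Zero is listed under both signs, which is
    harmless in an upper bound. *)
Fixpoint l1_points (N B : nat) : list (nat -> Z) :=
  match N with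
  | O => (fun _ => 0%Z) :: nil
  | S N' => flat_map (fun a =>
      flat_map (fun z => zupd z N' (Z.of_nat a) :: zupd z N' (- Z.of_nat a) :: nil)
               (l1_points N' (B - a))) (seq 0 (S B))
  end.

Lemma l1_points_S N B : l1_points (S N) B = flat_map (fun a =>
    flat_map (fun z => zupd z N (Z.of_nat a) :: zupd z N (- Z.of_nat a) :: nil)
             (l1_points N (B - a))) (seq 0 (S B)).
Proof. reflexivity. Qed.

Lemma l1_points_complete N : forall B z, rsum N (fun j => Rabs (IZR (z j))) <= INR B ->
  exists z', In z' (l1_points N B) /\ forall j, (j < N)%nat -> z' j = z j.
Proof.
  induction N; intros B z Hz.
  - exists (fun _ => 0%Z). split; [simpl; auto | lia].
  - simpl in Hz.
    assert (Habs : Rabs (IZR (z N)) = INR (Z.abs_nat (z N))).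
    { rewrite <- abs_IZR, INR_IZR_INZ, Zabs2Nat.id_abs. reflexivity. }
    assert (H0 : 0 <= rsum N (fun j => Rabs (IZR (z j))))
      by (apply rsum_nonneg; intros; apply Rabs_pos).
    rewrite Habs in Hz.
    assert (Hle : (Z.abs_nat (z N) <= B)%nat) by (apply INR_le; lra).
    destruct (IHN (B - Z.abs_nat (z N))%nat z) as (z' & Hin & Heq).
    { rewrite minus_INR by auto. lra. }
    exists (zupd z' N (z N)). split.
    + rewrite l1_points_S. apply in_flat_map. exists (Z.abs_nat (z N)). split.
      { apply in_seq. lia. }
      apply in_flat_map. exists z'. split; auto. simpl.
      destruct (Z.le_ge_cases 0 (z N)).
      * left. f_equal. lia.
      * right; left. f_equal. lia.
    + intros j Hj. unfold zupd. destruct (Nat.eqb_spec j N); subst; auto.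
      apply Heq. lia.
Qed.

Lemma length_flat_map_seq {X} (f : nat -> list X) s c :
  INR (length (flat_map f (seq s c))) = rsum c (fun a => INR (length (f (s + a)%nat))).
Proof.
  induction c; [reflexivity|].
  rewrite seq_S, flat_map_app, length_app, plus_INR, IHc. simpl. rewrite app_nil_r. reflexivity.
Qed.

Lemma length_flat_map_pair {X Y} (f g : X -> Y) (l : list X) :
  INR (length (flat_map (fun z => f z :: g z :: nil) l)) = 2 * INR (length l).
Proof.
  induction l; [simpl; ring|]. simpl flat_map; simpl length. rewrite !S_INR, IHl. ring.
Qed.

Lemma geometric_sum_le q n : 0 <= q < 1 -> rsum n (fun a => q ^ a) <= / (1 - q).
Proof.
  intros Hq.
  assert (E : rsum n (fun a => q ^ a) * (1 - q) = 1 - q ^ n).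
  { induction n; simpl; [ring|]. rewrite Rmult_plus_distr_r, IHn. ring. }
  assert (0 <= q ^ n) by (apply pow_le; lra).
  apply Rmult_le_reg_r with (1 - q); [lra|]. rewrite E, Rinv_l; lra.
Qed.

(** A generating function bound: with weight q^s for l1 norm s, at least q^B on the ball, the count
    factors over coordinates, and each coordinate contributes at most two geometric series. *)
Lemma l1_points_length q N : 0 < q < 1 ->
  forall B, INR (length (l1_points N B)) * q ^ B <= (2 * / (1 - q)) ^ N.
Proof.
  intros Hq. assert (Hp : 0 < / (1 - q)) by (apply Rinv_0_lt_compat; lra).
  induction N; intros B.
  - simpl. assert (q ^ B <= 1); [|lra].
    rewrite <- (pow1 B). apply pow_incr; lra.
  - rewrite l1_points_S.
    rewrite length_flat_map_seq, Rmult_comm, <- rsum_scal.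
    apply Rle_trans with (rsum (S B) (fun a => (2 * (2 * / (1 - q)) ^ N) * q ^ a)).
    + apply rsum_le. intros a Ha. rewrite length_flat_map_pair. simpl plus.
      assert (Eq : q ^ B = q ^ a * q ^ (B - a)) by (rewrite <- pow_add, Nat.add_comm, Nat.sub_add by lia; reflexivity).
      rewrite Eq. specialize (IHN (B - a)%nat).
      assert (0 < q ^ a) by (apply pow_lt; lra). nra.
    + rewrite rsum_scal, <- tech_pow_Rmult.
      generalize (geometric_sum_le q (S B) ltac:(lra)); intro.
      assert (0 <= (2 * / (1 - q)) ^ N) by (apply pow_le; lra).
      change (fun a => q ^ a) with (pow q) in H. nra.
Qed.

Lemma bernoulli_le x n : 0 <= x <= 1 -> 1 - INR n * x <= (1 - x) ^ n.
Proof.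
  intros Hx. induction n; [simpl; lra|]. rewrite S_INR. simpl.
  assert (0 <= INR n) by apply pos_INR.
  destruct (Rle_dec 0 (1 - INR n * x)); [nra|].
  assert (0 <= (1 - x) * (1 - x) ^ n); [|nra].
  apply Rmult_le_pos; [lra | apply pow_le; lra].
Qed.

Lemma l1_points_card N m : (1 <= m)%nat ->
  INR (length (l1_points N (N * m))) <= (8 * INR m) ^ N.
Proof.
  intros Hm. assert (Hm' : 1 <= INR m) by (apply (le_INR 1); auto).
  (* With q = 1 - x one has 2 / (1 - q) = 4 m, while Bernoulli keeps q^m above 1/2; this last factor
     turns 4 m into 8 m. *)
  set (x := / (2 * INR m)).
  assert (Hx : 0 < x <= 1 / 2).
  { unfold x. split; [apply Rinv_0_lt_compat; lra|].
    rewrite Rdiv_1_l. apply Rinv_le_contravar; lra. }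
  assert (Hmx : INR m * x = 1 / 2) by (unfold x; field; lra).
  generalize (l1_points_length (1 - x) N ltac:(lra) (N * m)); intro H.
  replace (2 * / (1 - (1 - x))) with (4 * INR m) in H by (unfold x; field; lra).
  assert (Hb : 1 / 2 <= (1 - x) ^ m).
  { generalize (bernoulli_le x m ltac:(lra)). lra. }
  assert (Hb' : (1 / 2) ^ N <= (1 - x) ^ (N * m)).
  { rewrite Nat.mul_comm, pow_mult. apply pow_incr; lra. }
  replace (8 * INR m) with (2 * (4 * INR m)) by ring. rewrite Rpow_mult_distr.
  assert (E : 2 ^ N * (1 / 2) ^ N = 1).
  { rewrite <- Rpow_mult_distr. replace (2 * (1 / 2)) with 1 by field. apply pow1. }
  assert (0 < 2 ^ N) by (apply pow_lt; lra).
  assert (0 <= INR (length (l1_points N (N * m)))) by apply pos_INR.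
  assert (INR (length (l1_points N (N * m))) * (1 / 2) ^ N <= (4 * INR m) ^ N) by nra.
  nra.
Qed.

(** * Exponential moments and greedy rounding *)

Lemma exp_mono x y : x <= y -> exp x <= exp y.
Proof.
  intros [H| ->]; [left; apply exp_increasing; auto | lra].
Qed.

(** The linear term is kept apart so that it cancels on averaging over a centred variable. For |t|
    <= 1/2 one uses exp t <= 1 / (1 - t) <= 1 + t + 2 t^2; outside, t <= 2 t^2 or 0 <= t + 2 t^2
    suffices. *)
Lemma exp_le_subgaussian t : exp t <= t + exp (2 * t ^ 2).
Proof.
  assert (H2 : 1 + 2 * t ^ 2 <= exp (2 * t ^ 2)) by apply exp_ineq1_le.
  destruct (Rlt_dec (1 / 2) t) as [H|H].
  - assert (exp t <= exp (2 * t ^ 2)); [|lra].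
    apply exp_mono. nra.
  - destruct (Rlt_dec t (- (1 / 2))) as [H'|H'].
    + assert (exp t <= exp 0) by (apply exp_mono; lra).
      rewrite exp_0 in *. nra.
    + assert (Hm : 1 - t <= exp (- t)) by (generalize (exp_ineq1_le (- t)); lra).
      assert (He : exp t * exp (- t) = 1) by (rewrite <- exp_plus, Rplus_opp_r; apply exp_0).
      assert (0 < exp t) by apply exp_pos.
      assert (exp t * (1 - t) <= 1) by nra.
      assert (1 <= (1 + t + 2 * t ^ 2) * (1 - t)) by nra.
      assert (exp t <= 1 + t + 2 * t ^ 2); [|lra].
      apply Rmult_le_reg_r with (1 - t); lra.
Qed.

(** The errors p - 1 and p, taken with probabilities p and 1 - p, have mean zero and absolute value
    at most 1. *)
Lemma two_point_mgf p b : 0 <= p <= 1 ->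
  p * exp (b * (p - 1)) + (1 - p) * exp (b * p) <= exp (2 * b ^ 2).
Proof.
  intros Hp.
  generalize (exp_le_subgaussian (b * (p - 1))) (exp_le_subgaussian (b * p)); intros H1 H2.
  assert (exp (2 * (b * (p - 1)) ^ 2) <= exp (2 * b ^ 2)).
  { apply exp_mono. rewrite Rpow_mult_distr. assert ((p - 1) ^ 2 <= 1) by nra.
    assert (0 <= b ^ 2) by apply pow2_ge_0. nra. }
  assert (exp (2 * (b * p) ^ 2) <= exp (2 * b ^ 2)).
  { apply exp_mono. rewrite Rpow_mult_distr. assert (p ^ 2 <= 1) by nra.
    assert (0 <= b ^ 2) by apply pow2_ge_0. nra. }
  nra.
Qed.

Lemma exists_floor y : exists a : Z, 0 <= y - IZR a < 1.
Proof.
  exists (up y - 1)%Z. rewrite minus_IZR. generalize (archimed y). lra.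
Qed.

(* Greedy form of randomised rounding: the two candidate roundings of [y],
   weighted by its fractional part, have mean zero error, and
   [exp t <= t + exp (2 t^2)] bounds their exponential moments. *)
Lemma greedy_rounding {X} (T : list X) (b : X -> nat -> R) N : forall (y : nat -> R) (w : X -> R),
  (forall x, 0 <= w x) ->
  exists z : nat -> Z, (forall t, (t < N)%nat -> Rabs (y t - IZR (z t)) <= 1) /\
    lsum T (fun x => w x * exp (rsum N (fun t => b x t * (y t - IZR (z t)))))
    <= lsum T (fun x => w x * exp (rsum N (fun t => 2 * b x t ^ 2))).
Proof.
  induction N; intros y w Hw.
  - exists (fun _ => 0%Z). split; [lia|]. simpl. lra.
  (* [G] estimates in advance the contribution of the coordinates below [N], which are rounded
     afterwards; the choice at [N] is made against this estimate. *)
  - set (G x := exp (rsum N (fun t => 2 * b x t ^ 2))).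
    assert (HG : forall x, 0 < G x) by (intros; apply exp_pos).
    assert (Hstep : exists a : Z, Rabs (y N - IZR a) <= 1 /\
      lsum T (fun x => w x * exp (b x N * (y N - IZR a)) * G x)
      <= lsum T (fun x => w x * exp (2 * b x N ^ 2) * G x)).
    { destruct (exists_floor (y N)) as [a Ha]. set (p := y N - IZR a) in *.
      set (S1 := lsum T (fun x => w x * exp (b x N * (p - 1)) * G x)).
      set (S2 := lsum T (fun x => w x * exp (b x N * p) * G x)).
      assert (Havg : p * S1 + (1 - p) * S2 <= lsum T (fun x => w x * exp (2 * b x N ^ 2) * G x)).
      { unfold S1, S2. rewrite <- lsum_lin. apply lsum_le. intros x _.
        generalize (two_point_mgf p (b x N) ltac:(lra)); intros Hm.
        assert (0 <= w x * G x) by (apply Rmult_le_pos; [auto | left; auto]). nra. }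
      (* The smaller of the two sums is at most their weighted average. *)
      destruct (Rle_dec S1 S2).
      - exists (a + 1)%Z. rewrite plus_IZR.
        replace (y N - (IZR a + 1)) with (p - 1) by (unfold p; ring).
        split; [apply Rabs_le; lra | fold S1; nra].
      - exists a. fold p. split; [apply Rabs_le; lra | fold S2; nra]. }
    destruct Hstep as (a & Ha & Hle).
    (* The factor of coordinate [N] is absorbed into the weights. *)
    destruct (IHN y (fun x => w x * exp (b x N * (y N - IZR a)))) as (z & Hz & Hs).
    { intros x. apply Rmult_le_pos; auto. left; apply exp_pos. }
    exists (zupd z N a). unfold zupd. split.
    + intros t Ht. destruct (Nat.eqb_spec t N); subst; auto. apply Hz; lia.
    + cbn [rsum]. rewrite Nat.eqb_refl.
      rewrite (lsum_ext T (fun x => w x * exp (rsum N _ + _))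
        (fun x => w x * exp (b x N * (y N - IZR a))
                  * exp (rsum N (fun t => b x t * (y t - IZR (z t)))))).
      2:{ intros x _. rewrite exp_plus.
          rewrite (rsum_ext N _ (fun t => b x t * (y t - IZR (z t)))); [ring|].
          intros t Ht. destruct (Nat.eqb_spec t N); [lia|auto]. }
      eapply Rle_trans; [apply Hs|]. fold (G). eapply Rle_trans; [apply Hle|].
      right. apply lsum_ext. intros x _. rewrite exp_plus. unfold G. ring.
Qed.

(** * Rounding real matrices in operator norm *)

Lemma floor_le_sq_sum k s (u : nat -> R) : 0 < s ->
  rsum k (fun i => Rabs (IZR (up (u i / s) - 1))) <= sqrt (INR k) * (nrm k u / s) + INR k.
Proof.
  intros Hs.
  apply Rle_trans with (rsum k (fun i => Rabs (u i / s) + 1)).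
  - apply rsum_le. intros i _. rewrite minus_IZR. generalize (archimed (u i / s)).
    intros. unfold Rabs; repeat destruct Rcase_abs; lra.
  - rewrite rsum_plus, rsum_const.
    assert (E : nrm k u / s = nrm k (fun i => u i / s)).
    { unfold Rdiv. rewrite Rmult_comm, <- nrm_scal by (left; apply Rinv_0_lt_compat; auto).
      apply nrm_ext. intros; ring. }
    rewrite E. generalize (rsum_abs_le k (fun i => u i / s)). lra.
Qed.

Lemma nrm_const k c : 0 <= c -> nrm k (fun _ => c) = sqrt (INR k) * c.
Proof.
  intros Hc. unfold nrm. rewrite rsum_const, sqrt_mult_alt, sqrt_pow2; auto. apply pos_INR.
Qed.

Lemma sqrt_INR_pos k : (1 <= k)%nat -> 0 < sqrt (INR k).
Proof. intros H. apply sqrt_lt_R0, lt_0_INR; lia. Qed.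

Lemma sqrt_INR_sq k : sqrt (INR k) * sqrt (INR k) = INR k.
Proof. apply sqrt_sqrt, pos_INR. Qed.

Lemma ball_net k : (1 <= k)%nat -> exists L : list (nat -> R),
  INR (length L) <= 40 ^ k /\ (forall u, In u L -> nrm k u <= 2) /\
  (forall u, nrm k u <= 1 -> exists u', In u' L /\ nrm k (fun i => u i - u' i) <= 1 / 4).
Proof.
  intros Hk. assert (Hq := sqrt_INR_pos k Hk). assert (Hqq := sqrt_INR_sq k).
  (* Spacing 1 / (4 sqrt k) makes the Euclidean rounding error at most 1/4. In units of [s] a unit
     vector has l1 norm at most 4 k, and floors add at most k: hence the budget 5 k and the base 40
     = 8 * 5. *)
  set (q := sqrt (INR k)) in *. set (s := / (4 * q)).
  assert (Hs : 0 < s) by (apply Rinv_0_lt_compat; lra).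
  assert (Hqs : q * s = 1 / 4) by (unfold s; field; lra).
  (* Some points of the l1 ball are far from the unit ball. Those within 1/4 of it have norm at most
     5/4 and survive the filter. *)
  exists (filter (fun u => if Rle_dec (nrm k u) 2 then true else false)
            (map (fun z i => s * IZR (z i)) (l1_points k (k * 5)))).
  split; [|split].
  - eapply Rle_trans; [apply le_INR, filter_length_le|]. rewrite length_map.
    eapply Rle_trans; [apply l1_points_card; lia|]. right; f_equal. simpl; ring.
  - intros u Hu. apply filter_In in Hu. destruct Hu as [_ Hu].
    destruct (Rle_dec (nrm k u) 2); [auto|discriminate].
  - intros u Hu.
    destruct (l1_points_complete k (k * 5) (fun i => (up (u i / s) - 1)%Z)) as (z & Hz & Hzu).
    { eapply Rle_trans; [apply floor_le_sq_sum; auto|].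
      rewrite mult_INR. fold q. assert (nrm k u / s <= 4 * q).
      { unfold Rdiv, s. rewrite Rinv_inv. generalize (nrm_nonneg k u). nra. }
      replace (INR 5) with 5 by (simpl; ring). nra. }
    assert (Hd : nrm k (fun i => u i - s * IZR (z i)) <= 1 / 4).
    { rewrite <- nrm_abs. rewrite <- Hqs. unfold q. rewrite <- nrm_const by lra.
      apply nrm_le. intros i Hi. split; [apply Rabs_pos|].
      rewrite Hzu by auto. rewrite minus_IZR.
      replace (u i - _) with (s * (u i / s - (IZR (up (u i / s)) - 1))) by (field; lra).
      generalize (archimed (u i / s)). intros. apply Rabs_le. nra. }
    exists (fun i => s * IZR (z i)). split; auto.
    apply filter_In. split; [apply in_map_iff; eauto|].
    destruct Rle_dec as [|n]; auto. exfalso; apply n.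
    replace (nrm k _) with (nrm k (fun i => u i + Rabs (u i - s * IZR (z i)) *
       (if Rle_dec 0 (u i - s * IZR (z i)) then -1 else 1))).
    2:{ apply nrm_ext. intros i _. unfold Rabs; destruct Rle_dec, Rcase_abs; lra. }
    eapply Rle_trans; [apply nrm_triangle|].
    rewrite <- (nrm_abs k (fun i => Rabs _ * _)).
    rewrite (nrm_ext k (fun i => Rabs (Rabs _ * _)) (fun i => Rabs (u i - s * IZR (z i)))).
    2:{ intros i _. rewrite Rabs_mult, Rabs_Rabsolu.
        destruct Rle_dec; unfold Rabs at 2; destruct Rcase_abs; lra. }
    rewrite nrm_abs. lra.
Qed.

Lemma div_flat k i j : (j < k)%nat -> ((i * k + j) / k = i)%nat.
Proof. intros. rewrite Nat.div_add_l, Nat.div_small; lia. Qed.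

Lemma mod_flat k i j : (j < k)%nat -> ((i * k + j) mod k = j)%nat.
Proof. intros. rewrite Nat.add_comm, Nat.Div0.mod_add, Nat.mod_small; lia. Qed.

(** The form u^T E v. It is linear in the entries of [E], so its exponential factors over them, and
    its supremum over unit vectors is the operator norm of [E]. *)
Definition bil (k : nat) (E : nat -> nat -> R) (u v : nat -> R) : R :=
  rsum k (fun i => rsum k (fun j => E i j * (u i * v j))).

Lemma bil_sub_l k E u u' v : bil k E (fun i => u i - u' i) v = bil k E u v - bil k E u' v.
Proof.
  unfold bil, Rminus.
  replace (- rsum k (fun i => rsum k (fun j => E i j * (u' i * v j))))
    with (-1 * rsum k (fun i => rsum k (fun j => E i j * (u' i * v j)))) by ring.
  rewrite <- rsum_scal, <- rsum_plus. apply rsum_ext; intros.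
  rewrite <- rsum_scal, <- rsum_plus. apply rsum_ext; intros. ring.
Qed.

Lemma bil_sub_r k E u v v' : bil k E u (fun i => v i - v' i) = bil k E u v - bil k E u v'.
Proof.
  unfold bil, Rminus.
  replace (- rsum k (fun i => rsum k (fun j => E i j * (u i * v' j))))
    with (-1 * rsum k (fun i => rsum k (fun j => E i j * (u i * v' j)))) by ring.
  rewrite <- rsum_scal, <- rsum_plus. apply rsum_ext; intros.
  rewrite <- rsum_scal, <- rsum_plus. apply rsum_ext; intros. ring.
Qed.

Lemma bil_scal k E a b u v :
  bil k E (fun i => a * u i) (fun j => b * v j) = a * b * bil k E u v.
Proof.
  unfold bil. rewrite <- rsum_scal. apply rsum_ext; intros.
  rewrite <- rsum_scal. apply rsum_ext; intros. ring.
Qed.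

Lemma coord_le_nrm k u i : (i < k)%nat -> Rabs (u i) <= nrm k u.
Proof.
  intros Hi. apply sq_le_inv; [apply nrm_nonneg|]. rewrite nrm_sq, pow2_abs.
  apply (rsum_term_le k (fun i => u i ^ 2)); auto. intros; apply pow2_ge_0.
Qed.

Lemma bil_homogeneous k E K :
  (forall u v, nrm k u <= 1 -> nrm k v <= 1 -> bil k E u v <= K) ->
  forall u v, bil k E u v <= K * nrm k u * nrm k v.
Proof.
  intros H u v.
  destruct (Rle_lt_or_eq_dec 0 _ (nrm_nonneg k u)) as [Hu|Hu];
  [destruct (Rle_lt_or_eq_dec 0 _ (nrm_nonneg k v)) as [Hv|Hv]|].
  - set (a := nrm k u) in *. set (b := nrm k v) in *.
    assert (Ha : 0 < / a) by (apply Rinv_0_lt_compat; auto).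
    assert (Hb : 0 < / b) by (apply Rinv_0_lt_compat; auto).
    generalize (H (fun i => / a * u i) (fun i => / b * v i)).
    rewrite bil_scal, !nrm_scal by lra. fold a b. rewrite !Rinv_l by lra.
    intros H'. specialize (H' ltac:(lra) ltac:(lra)).
    replace (bil k E u v) with (a * b * (/ a * / b * bil k E u v)) by (field; lra).
    assert (0 < a * b) by nra. nra.
  - rewrite <- Hv. replace (bil k E u v) with 0; [lra|].
    symmetry. unfold bil. rewrite <- (Rmult_0_r (INR k)), <- rsum_const.
    apply rsum_ext; intros i Hi. rewrite <- (Rmult_0_r (INR k)), <- rsum_const.
    apply rsum_ext; intros j Hj. generalize (coord_le_nrm k v j Hj). rewrite <- Hv.
    intros Ha. assert (v j = 0) by (unfold Rabs in Ha; destruct Rcase_abs; lra).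
    rewrite H0; ring.
  - rewrite <- Hu. replace (bil k E u v) with 0; [lra|].
    symmetry. unfold bil. rewrite <- (Rmult_0_r (INR k)), <- rsum_const.
    apply rsum_ext; intros i Hi. rewrite <- (Rmult_0_r (INR k)), <- rsum_const.
    apply rsum_ext; intros j Hj. generalize (coord_le_nrm k u i Hi). rewrite <- Hu.
    intros Ha. assert (u i = 0) by (unfold Rabs in Ha; destruct Rcase_abs; lra).
    rewrite H0; ring.
Qed.

(** If K is the supremum over unit vectors, passing to net points of norm at most 2 changes the form
    by at most K/4 + 2 K/4, so K <= T + 3 K/4. Absorbing K requires it to be finite, which the bound
    on the entries ensures. *)
Lemma bil_le_of_net k E (L : list (nat -> R)) T :
  (forall i j, (i < k)%nat -> (j < k)%nat -> Rabs (E i j) <= 1) ->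
  (forall u, In u L -> nrm k u <= 2) ->
  (forall u, nrm k u <= 1 -> exists u', In u' L /\ nrm k (fun i => u i - u' i) <= 1 / 4) ->
  (forall u v, In u L -> In v L -> bil k E u v <= T) ->
  forall u v, bil k E u v <= 4 * T * nrm k u * nrm k v.
Proof.
  intros HE HL Hnet HT. apply bil_homogeneous.
  set (S r := exists u v, nrm k u <= 1 /\ nrm k v <= 1 /\ r = bil k E u v).
  destruct (completeness S) as [K [HK1 HK2]].
  { exists (INR k * (INR k * 1)). intros r (u & v & Hu & Hv & ->).
    unfold bil. rewrite <- !rsum_const. apply rsum_le; intros i Hi. apply rsum_le; intros j Hj.
    generalize (coord_le_nrm k u i Hi) (coord_le_nrm k v j Hj) (HE i j Hi Hj); intros.
    eapply Rle_trans; [apply Rle_abs|]. rewrite !Rabs_mult.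
    assert (0 <= Rabs (u i)) by apply Rabs_pos. assert (0 <= Rabs (v j)) by apply Rabs_pos.
    assert (0 <= Rabs (E i j)) by apply Rabs_pos.
    assert (Rabs (u i) * Rabs (v j) <= 1) by nra.
    assert (0 <= Rabs (u i) * Rabs (v j)) by nra. nra. }
  { exists (bil k E (fun _ => 0) (fun _ => 0)), (fun _ => 0), (fun _ => 0).
    rewrite nrm_const by lra. lra. }
  assert (HK : forall u v, nrm k u <= 1 -> nrm k v <= 1 -> bil k E u v <= K).
  { intros u v Hu Hv. apply HK1. exists u, v; auto. }
  assert (HK0 : 0 <= K).
  { replace 0 with (bil k E (fun i => 0 * 0) (fun i => 0 * 0)).
    - apply HK; rewrite nrm_scal, nrm_const by lra; lra.
    - rewrite (bil_scal k E 0 0 (fun _ => 0) (fun _ => 0)); ring. }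
  assert (Hh := bil_homogeneous k E K HK).
  assert (Himp : K <= T + 3 / 4 * K).
  { apply HK2. intros r (u & v & Hu & Hv & ->).
    destruct (Hnet u Hu) as (u' & Hu' & Hdu). destruct (Hnet v Hv) as (v' & Hv' & Hdv).
    generalize (Hh (fun i => u i - u' i) v) (Hh u' (fun i => v i - v' i)) (HT u' v' Hu' Hv').
    rewrite bil_sub_l, bil_sub_r. generalize (HL u' Hu').
    generalize (nrm_nonneg k v) (nrm_nonneg k u') (nrm_nonneg k (fun i => u i - u' i))
      (nrm_nonneg k (fun i => v i - v' i)).
    set (a := nrm k (fun i => u i - u' i)) in *. set (b := nrm k (fun i => v i - v' i)) in *.
    intros.
    assert (a * nrm k v <= 1 / 4) by nra. assert (nrm k u' * b <= 1 / 2) by nra.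
    assert (K * (a * nrm k v) <= K * (1 / 4)) by (apply Rmult_le_compat_l; auto).
    assert (K * (nrm k u' * b) <= K * (1 / 2)) by (apply Rmult_le_compat_l; auto).
    lra. }
  intros u v Hu Hv. generalize (HK u v Hu Hv). lra.
Qed.

(** Summing over pairs of net points costs 40^(2k), and with the multiplier q = sqrt k each pair (a,
    b) contributes at most exp(2 k |a|^2 |b|^2) <= exp(32 k). So q times the form is O(k) on the
    net, and the form itself is O(sqrt k), the order of a random matrix with bounded centred
    entries. *)
Lemma integer_rounding_bil : exists Cr, 0 < Cr /\ forall k (Y : nat -> nat -> R), (1 <= k)%nat ->
  exists Z : nat -> nat -> Z,
    (forall i j, (i < k)%nat -> (j < k)%nat -> Rabs (Y i j - IZR (Z i j)) <= 1) /\
    forall u v, bil k (fun i j => Y i j - IZR (Z i j)) u v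
                <= Cr * sqrt (INR k) * nrm k u * nrm k v.
Proof.
  assert (Hln : 0 <= ln 40) by (rewrite <- ln_1; left; apply ln_increasing; lra).
  exists (4 * (2 * ln 40 + 32)). split; [lra|].
  intros k Y Hk. destruct (ball_net k Hk) as (L & Hcard & HL & Hnet).
  assert (Hq := sqrt_INR_pos k Hk). assert (Hqq := sqrt_INR_sq k).
  set (q := sqrt (INR k)) in *.
  destruct (greedy_rounding (list_prod L L)
    (fun p t => q * (fst p (t / k)%nat * snd p (t mod k)%nat)) (k * k)
    (fun t => Y (t / k)%nat (t mod k)%nat) (fun _ => 1)) as (z & Hz & Hs); [intros; lra|].
  set (Z i j := z (i * k + j)%nat).
  assert (HZ : forall i j, (i < k)%nat -> (j < k)%nat -> Rabs (Y i j - IZR (Z i j)) <= 1).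
  { intros i j Hi Hj. specialize (Hz (i * k + j)%nat). simpl in Hz.
    rewrite div_flat, mod_flat in Hz by auto. apply Hz. nia. }
  exists Z. split; auto. intros u v.
  replace (4 * (2 * ln 40 + 32) * q) with (4 * ((2 * ln 40 + 32) * q)) by ring.
  apply (bil_le_of_net k _ L); auto.
  clear u v. intros u v Hu Hv.
  assert (Hin : In (u, v) (list_prod L L)) by (apply in_prod; auto).
  assert (H1 : exp (q * bil k (fun i j => Y i j - IZR (Z i j)) u v)
               <= INR (length (list_prod L L)) * exp (32 * INR k)).
  { eapply Rle_trans; [|eapply Rle_trans; [apply Hs|]].
    - eapply Rle_trans; [|apply (lsum_term_le _ _ (u, v)); auto].
      2:{ intros p _. rewrite Rmult_1_l. left; apply exp_pos. }
      cbn [fst snd]. rewrite Rmult_1_l. right. f_equal.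
      rewrite rsum_flatten. unfold bil. rewrite <- rsum_scal. apply rsum_ext; intros i Hi.
      rewrite <- rsum_scal. apply rsum_ext; intros j Hj. rewrite div_flat, mod_flat by auto.
      unfold Z. ring.
    - rewrite <- lsum_const. apply lsum_le. intros [a b] Hab. cbn [fst snd].
      apply in_prod_iff in Hab. destruct Hab as [Ha Hb].
      rewrite Rmult_1_l. apply exp_mono.
      rewrite rsum_flatten.
      rewrite (rsum_ext k _ (fun i => 2 * INR k * nrm k b ^ 2 * a i ^ 2)).
      2:{ intros i Hi. rewrite nrm_sq, <- Hqq.
          replace (2 * (q * q) * rsum k (fun i0 => b i0 ^ 2) * a i ^ 2)
            with ((2 * (q * q) * a i ^ 2) * rsum k (fun i0 => b i0 ^ 2)) by ring.
          rewrite <- rsum_scal. apply rsum_ext; intros j Hj. rewrite div_flat, mod_flat by auto. ring. }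
      rewrite rsum_scal, <- nrm_sq.
      assert (nrm k a ^ 2 <= 4) by (generalize (HL a Ha) (nrm_nonneg k a); nra).
      assert (nrm k b ^ 2 <= 4) by (generalize (HL b Hb) (nrm_nonneg k b); nra).
      assert (0 <= nrm k a ^ 2) by apply pow2_ge_0. assert (0 <= nrm k b ^ 2) by apply pow2_ge_0.
      assert (nrm k b ^ 2 * nrm k a ^ 2 <= 16) by nra.
      generalize (pos_INR k); intro. nra. }
  assert (H2 : INR (length (list_prod L L)) <= exp (2 * INR k * ln 40)).
  { rewrite length_prod, mult_INR.
    replace (exp (2 * INR k * ln 40)) with (40 ^ k * 40 ^ k).
    - generalize (pos_INR (length L)). nra.
    - rewrite <- Rpower_pow by lra. unfold Rpower. rewrite <- exp_plus. f_equal. ring. }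
  assert (H3 : exp (q * bil k (fun i j => Y i j - IZR (Z i j)) u v)
               <= exp ((2 * ln 40 + 32) * q * q)).
  { eapply Rle_trans; [apply H1|].
    replace ((2 * ln 40 + 32) * q * q) with (2 * INR k * ln 40 + 32 * INR k)
      by (rewrite <- Hqq; ring).
    rewrite exp_plus. apply Rmult_le_compat_r; auto. left; apply exp_pos. }
  apply Rmult_le_reg_r with q; auto.
  destruct (Rle_dec (bil k (fun i j => Y i j - IZR (Z i j)) u v * q)
              ((2 * ln 40 + 32) * q * q)) as [|n]; auto.
  exfalso. apply Rnot_le_lt in n. apply exp_increasing in n.
  rewrite (Rmult_comm q) in H3. lra.
Qed.

(** * Complex matrices *)

Lemma C_eq z w : CRe z = CRe w -> CIm z = CIm w -> z = w.
Proof. destruct z, w; simpl; intros; subst; reflexivity. Qed.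

Ltac cring := intros; apply C_eq; simpl; ring.

Lemma Cmod_nonneg z : 0 <= Cmod z.
Proof. apply sqrt_pos. Qed.

Lemma Cmod_sq z : Cmod z ^ 2 = CRe z ^ 2 + CIm z ^ 2.
Proof. apply pow2_sqrt. generalize (pow2_ge_0 (CRe z)) (pow2_ge_0 (CIm z)); lra. Qed.

Lemma Cmod_mul z w : Cmod (Cmul z w) = Cmod z * Cmod w.
Proof.
  unfold Cmod. rewrite <- sqrt_mult_alt.
  - f_equal. simpl; ring.
  - generalize (pow2_ge_0 (CRe z)) (pow2_ge_0 (CIm z)); lra.
Qed.

Lemma Re_dot_le z w : CRe z * CRe w + CIm z * CIm w <= Cmod z * Cmod w.
Proof.
  apply sq_le_inv; [apply Rmult_le_pos; apply Cmod_nonneg|].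
  rewrite Rpow_mult_distr, !Cmod_sq.
  generalize (pow2_ge_0 (CRe z * CIm w - CIm z * CRe w)). nra.
Qed.

Lemma Cmod_triangle z w : Cmod (Cadd z w) <= Cmod z + Cmod w.
Proof.
  generalize (Cmod_nonneg z) (Cmod_nonneg w); intros.
  apply sq_le_inv; [lra|].
  generalize (Re_dot_le z w) (Cmod_sq z) (Cmod_sq w) (Cmod_sq (Cadd z w)). simpl CRe; simpl CIm.
  nra.
Qed.

Lemma Cmod_opp z : Cmod (Copp z) = Cmod z.
Proof. unfold Cmod. f_equal. simpl; ring. Qed.

Lemma Cmod_conj z : Cmod (Cconj z) = Cmod z.
Proof. unfold Cmod. f_equal. simpl; ring. Qed.

Lemma Cmod_0 : Cmod C0 = 0.
Proof. unfold Cmod. simpl. replace (_ + _) with 0 by ring. apply sqrt_0. Qed.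

Lemma CRe_csum k f : CRe (csum k f) = rsum k (fun i => CRe (f i)).
Proof. induction k; simpl; congruence. Qed.

Lemma CIm_csum k f : CIm (csum k f) = rsum k (fun i => CIm (f i)).
Proof. induction k; simpl; congruence. Qed.

Lemma csum_ext k f g : (forall i, (i < k)%nat -> f i = g i) -> csum k f = csum k g.
Proof. induction k; simpl; intros H; auto. rewrite IHk, H by auto with arith. reflexivity. Qed.

Lemma csum_add k f g : csum k (fun i => Cadd (f i) (g i)) = Cadd (csum k f) (csum k g).
Proof. apply C_eq; simpl; rewrite ?CRe_csum, ?CIm_csum, <- rsum_plus; reflexivity. Qed.

Lemma csum_mul_l k c f : Cmul c (csum k f) = csum k (fun i => Cmul c (f i)).
Proof. induction k; simpl; [cring | rewrite <- IHk; cring]. Qed.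

Lemma csum_mul_r k c f : Cmul (csum k f) c = csum k (fun i => Cmul (f i) c).
Proof. induction k; simpl; [cring | rewrite <- IHk; cring]. Qed.

Lemma csum_opp k f : Copp (csum k f) = csum k (fun i => Copp (f i)).
Proof. induction k; simpl; [cring | rewrite <- IHk; cring]. Qed.

Lemma csum_conj k f : Cconj (csum k f) = csum k (fun i => Cconj (f i)).
Proof. induction k; simpl; [cring | rewrite <- IHk; cring]. Qed.

Lemma csum_swap k m (f : nat -> nat -> _) :
  csum k (fun i => csum m (f i)) = csum m (fun j => csum k (fun i => f i j)).
Proof.
  apply C_eq; rewrite ?CRe_csum, ?CIm_csum.
  - rewrite (rsum_ext k _ (fun i => rsum m (fun j => CRe (f i j)))) by (intros; apply CRe_csum).
    rewrite rsum_swap. apply rsum_ext; intros. symmetry; apply CRe_csum.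
  - rewrite (rsum_ext k _ (fun i => rsum m (fun j => CIm (f i j)))) by (intros; apply CIm_csum).
    rewrite rsum_swap. apply rsum_ext; intros. symmetry; apply CIm_csum.
Qed.

Lemma Cmod_csum_le k f : Cmod (csum k f) <= rsum k (fun i => Cmod (f i)).
Proof.
  induction k; simpl; [rewrite Cmod_0; lra|].
  eapply Rle_trans; [apply Cmod_triangle|]. lra.
Qed.

(** * Vector norms, operator bounds and the Hilbert-Schmidt norm *)

Lemma vnorm_nrm k v : vnorm k v = nrm k (fun i => Cmod (v i)).
Proof. reflexivity. Qed.

Lemma vnorm_nonneg k v : 0 <= vnorm k v.
Proof. apply nrm_nonneg. Qed.

Lemma vnorm_ext k u v : (forall i, (i < k)%nat -> u i = v i) -> vnorm k u = vnorm k v.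
Proof. intros H. apply nrm_ext. intros; rewrite H; auto. Qed.

Lemma vnorm_triangle k u v : vnorm k (fun i => Cadd (u i) (v i)) <= vnorm k u + vnorm k v.
Proof.
  rewrite !vnorm_nrm. eapply Rle_trans; [|apply nrm_triangle].
  apply nrm_le. intros. split; [apply Cmod_nonneg | apply Cmod_triangle].
Qed.

Lemma vnorm_smul k c v : vnorm k (fun i => Cmul c (v i)) = Cmod c * vnorm k v.
Proof.
  rewrite !vnorm_nrm, <- nrm_scal by apply Cmod_nonneg. apply nrm_ext. intros; apply Cmod_mul.
Qed.

(** The real part of the Hermitian inner product, which suffices for norms and adjoints. *)
Definition re_dot (k : nat) (u v : Vec) : R :=
  rsum k (fun i => CRe (u i) * CRe (v i) + CIm (u i) * CIm (v i)).

Lemma re_dot_self k v : re_dot k v v = vnorm k v ^ 2.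
Proof.
  rewrite vnorm_nrm, nrm_sq. apply rsum_ext; intros. rewrite Cmod_sq; ring.
Qed.

Lemma re_dot_le k u v : re_dot k u v <= vnorm k u * vnorm k v.
Proof.
  eapply Rle_trans; [|apply cauchy_schwarz]. apply rsum_le; intros; apply Re_dot_le.
Qed.

Lemma re_dot_ext k u u' v v' : (forall i, (i < k)%nat -> u i = u' i) ->
  (forall i, (i < k)%nat -> v i = v' i) -> re_dot k u v = re_dot k u' v'.
Proof. intros H H'. apply rsum_ext; intros. rewrite H, H'; auto. Qed.

Lemma re_dot_adj k M u v : re_dot k (mat_vec k M u) v = re_dot k u (mat_vec k (mat_adj M) v).
Proof.
  unfold re_dot, mat_vec.
  rewrite (rsum_ext k _ (fun i => rsum k (fun j =>
    CRe (v i) * CRe (Cmul (M i j) (u j)) + CIm (v i) * CIm (Cmul (M i j) (u j))))).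
  2:{ intros i _. rewrite CRe_csum, CIm_csum, rsum_plus, !rsum_scal. ring. }
  rewrite rsum_swap. apply rsum_ext; intros j _.
  rewrite CRe_csum, CIm_csum, <- !rsum_scal, <- rsum_plus. apply rsum_ext; intros i _.
  unfold mat_adj. simpl. ring.
Qed.

Lemma mat_vec_ext k M N u v : mat_eqk k M N -> (forall i, (i < k)%nat -> u i = v i) ->
  forall i, (i < k)%nat -> mat_vec k M u i = mat_vec k N v i.
Proof. intros H H' i Hi. apply csum_ext; intros. rewrite H, H'; auto. Qed.

Lemma mat_vec_mul k M N v : mat_vec k (mat_mul k M N) v = mat_vec k M (mat_vec k N v).
Proof.
  extensionality i. unfold mat_vec, mat_mul.
  rewrite (csum_ext k _ (fun j => csum k (fun l => Cmul (Cmul (M i l) (N l j)) (v j))))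
    by (intros; apply csum_mul_r).
  rewrite csum_swap. apply csum_ext; intros l _. rewrite csum_mul_l.
  apply csum_ext; intros; cring.
Qed.

Lemma mat_vec_smul k M c v :
  mat_vec k M (fun i => Cmul c (v i)) = (fun i => Cmul c (mat_vec k M v i)).
Proof.
  extensionality i. unfold mat_vec. rewrite csum_mul_l. apply csum_ext; intros; cring.
Qed.

Lemma csum_delta k i c v : (i < k)%nat ->
  csum k (fun j => Cmul (if Nat.eqb i j then c else C0) (v j)) = Cmul c (v i).
Proof.
  induction k; intros Hi; [lia|]. simpl.
  destruct (Nat.eqb_spec i k) as [->|Hn].
  - rewrite (csum_ext k _ (fun _ => Cmul C0 C0)).
    + rewrite <- csum_mul_l. cring.
    + intros j Hj. destruct (Nat.eqb_spec k j); [lia|]. cring.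
  - rewrite IHk by lia. cring.
Qed.

Lemma mat_vec_1 k v i : (i < k)%nat -> mat_vec k (mat_scal k C1) v i = v i.
Proof.
  intros Hi. unfold mat_vec, mat_scal. apply Nat.ltb_lt in Hi as Hi'. rewrite Hi'.
  simpl. rewrite csum_delta by auto. cring.
Qed.

(** [op_norm] is a supremum picked by [epsilon]. This predicate carries its bounds without the
    choice; [op_bounded_op_norm] and [op_norm_le] pass between the two. *)
Definition op_bounded (k : nat) (M : Mat) (c : R) : Prop :=
  forall v, vnorm k (mat_vec k M v) <= c * vnorm k v.

Lemma op_bounded_ext k M N c : mat_eqk k M N -> op_bounded k M c -> op_bounded k N c.
Proof.
  intros H HM v. rewrite <- (vnorm_ext k (mat_vec k M v)); auto.
  apply mat_vec_ext; auto.
Qed.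

Lemma op_bounded_adj k M c : 0 <= c -> op_bounded k M c -> op_bounded k (mat_adj M) c.
Proof.
  intros Hc HM v. set (w := mat_vec k (mat_adj M) v).
  assert (H : vnorm k w ^ 2 <= c * vnorm k w * vnorm k v).
  { rewrite <- re_dot_self. unfold w at 2. rewrite <- re_dot_adj.
    eapply Rle_trans; [apply re_dot_le|]. apply Rmult_le_compat_r; [apply vnorm_nonneg | apply HM]. }
  destruct (Rle_lt_or_eq_dec 0 _ (vnorm_nonneg k w)) as [Hw|Hw].
  - apply Rmult_le_reg_r with (vnorm k w); auto. lra.
  - rewrite <- Hw. apply Rmult_le_pos; auto. apply vnorm_nonneg.
Qed.

(** The unnormalised Hilbert-Schmidt norm, sqrt k times the one defined by [tau]; hence the factors
    [sqrt (INR k)] below. Taken column by column, it reduces left multiplication to the action on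
    vectors. *)
Definition fnorm (k : nat) (M : Mat) : R := nrm k (fun j => vnorm k (fun i => M i j)).

Lemma fnorm_nonneg k M : 0 <= fnorm k M.
Proof. apply nrm_nonneg. Qed.

Lemma fnorm_sq k M : fnorm k M ^ 2 = rsum k (fun j => rsum k (fun i => Cmod (M i j) ^ 2)).
Proof.
  unfold fnorm. rewrite nrm_sq. apply rsum_ext; intros. rewrite vnorm_nrm. apply nrm_sq.
Qed.

Lemma fnorm_ext k M N : mat_eqk k M N -> fnorm k M = fnorm k N.
Proof. intros H. apply nrm_ext; intros. apply vnorm_ext; intros. auto. Qed.

Lemma fnorm_adj k M : fnorm k (mat_adj M) = fnorm k M.
Proof.
  assert (E : fnorm k (mat_adj M) ^ 2 = fnorm k M ^ 2).
  { rewrite !fnorm_sq, rsum_swap. apply rsum_ext; intros. apply rsum_ext; intros.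
    unfold mat_adj. rewrite Cmod_conj. reflexivity. }
  apply Rle_antisym; apply sq_le_inv; try apply fnorm_nonneg; lra.
Qed.

Lemma fnorm_add k M N : fnorm k (mat_add M N) <= fnorm k M + fnorm k N.
Proof.
  unfold fnorm at 2 3. eapply Rle_trans; [|apply nrm_triangle].
  apply nrm_le; intros. split; [apply vnorm_nonneg|].
  apply (vnorm_triangle k (fun i0 => M i0 i) (fun i0 => N i0 i)).
Qed.

Lemma fnorm_sub_comm k M N : fnorm k (mat_sub M N) = fnorm k (mat_sub N M).
Proof.
  apply nrm_ext; intros. rewrite !vnorm_nrm. apply nrm_ext; intros.
  rewrite <- Cmod_opp. f_equal. unfold mat_sub. cring.
Qed.

Lemma fnorm_mul_l k M N c : 0 <= c -> op_bounded k M c -> fnorm k (mat_mul k M N) <= c * fnorm k N.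
Proof.
  intros Hc H. unfold fnorm. rewrite <- nrm_scal by auto.
  apply nrm_le; intros. split; [apply vnorm_nonneg|].
  apply (H (fun l => N l i)).
Qed.

Lemma mat_adj_mul k M N : mat_adj (mat_mul k M N) = mat_mul k (mat_adj N) (mat_adj M).
Proof.
  extensionality i; extensionality j. unfold mat_adj, mat_mul. rewrite csum_conj.
  apply csum_ext; intros; cring.
Qed.

Lemma mat_adj_adj M : mat_adj (mat_adj M) = M.
Proof. extensionality i; extensionality j. unfold mat_adj. cring. Qed.

Lemma fnorm_mul_r k M N c : 0 <= c -> op_bounded k N c -> fnorm k (mat_mul k M N) <= c * fnorm k M.
Proof.
  intros Hc H. rewrite <- fnorm_adj, mat_adj_mul, <- (fnorm_adj k M).
  apply fnorm_mul_l; auto. apply op_bounded_adj; auto.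
Qed.

Lemma op_bounded_fnorm k M : op_bounded k M (fnorm k M).
Proof.
  intros v. rewrite <- fnorm_adj.
  unfold fnorm. rewrite Rmult_comm, <- nrm_scal by apply vnorm_nonneg.
  rewrite vnorm_nrm. apply nrm_le; intros i Hi. split; [apply Cmod_nonneg|].
  unfold mat_vec. eapply Rle_trans; [apply Cmod_csum_le|].
  rewrite Rmult_comm. eapply Rle_trans; [|apply cauchy_schwarz].
  apply rsum_le; intros. rewrite Cmod_mul. unfold mat_adj. rewrite Cmod_conj. lra.
Qed.

Lemma vnorm_0 k : vnorm k (fun _ => C0) = 0.
Proof.
  rewrite vnorm_nrm. rewrite (nrm_ext k _ (fun _ => 0)) by (intros; apply Cmod_0).
  unfold nrm. rewrite rsum_const. replace (_ * _) with 0 by ring. apply sqrt_0.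
Qed.

Lemma op_norm_lub k M :
  is_lub (fun r => exists v, vnorm k v <= 1 /\ r = vnorm k (mat_vec k M v)) (op_norm k M).
Proof.
  unfold op_norm, Rsup. apply epsilon_spec.
  destruct (completeness (fun r => exists v, vnorm k v <= 1 /\ r = vnorm k (mat_vec k M v)))
    as [l Hl]; [| |exists l; auto].
  - exists (fnorm k M). intros r (v & Hv & ->). generalize (op_bounded_fnorm k M v) (fnorm_nonneg k M).
    nra.
  - exists (vnorm k (mat_vec k M (fun _ => C0))), (fun _ => C0). rewrite vnorm_0. split; lra.
Qed.

Lemma Cmod_real a : 0 <= a -> Cmod (mkC a 0) = a.
Proof.
  intros Ha. unfold Cmod; simpl CRe; simpl CIm.
  replace (a ^ 2 + 0 ^ 2) with (a ^ 2) by ring. apply sqrt_pow2; auto.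
Qed.

Lemma op_bounded_op_norm k M : op_bounded k M (op_norm k M).
Proof.
  intros v. destruct (op_norm_lub k M) as [H _].
  destruct (Rle_lt_or_eq_dec 0 _ (vnorm_nonneg k v)) as [Hv|Hv].
  - set (a := vnorm k v) in *. assert (Ha : 0 < / a) by (apply Rinv_0_lt_compat; auto).
    assert (H1 : vnorm k (mat_vec k M (fun i => Cmul (mkC (/ a) 0) (v i))) <= op_norm k M).
    { apply H. eexists. split; [|reflexivity]. rewrite vnorm_smul, Cmod_real by lra.
      fold a. rewrite Rinv_l; lra. }
    rewrite mat_vec_smul, vnorm_smul, Cmod_real in H1 by lra.
    apply Rmult_le_reg_l with (/ a); auto.
    replace (/ a * (op_norm k M * a)) with (op_norm k M) by (field; lra). auto.
  - rewrite <- Hv. generalize (op_bounded_fnorm k M v). rewrite <- Hv. lra.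
Qed.

Lemma op_norm_le k M c : 0 <= c -> op_bounded k M c -> op_norm k M <= c.
Proof.
  intros Hc H. apply (op_norm_lub k M). intros r (v & Hv & ->).
  generalize (H v). nra.
Qed.

Lemma op_bounded_le k M c d : c <= d -> op_bounded k M c -> op_bounded k M d.
Proof. intros Hcd H v. generalize (H v) (vnorm_nonneg k v). nra. Qed.

Lemma mat_mul_assoc k M N P : mat_mul k (mat_mul k M N) P = mat_mul k M (mat_mul k N P).
Proof.
  extensionality i; extensionality j.
  change (mat_vec k (mat_mul k M N) (fun l => P l j) i
          = mat_vec k M (mat_vec k N (fun l => P l j)) i).
  rewrite mat_vec_mul. reflexivity.
Qed.

Lemma mat_mul_sub_l k M N P :
  mat_mul k (mat_sub M N) P = mat_sub (mat_mul k M P) (mat_mul k N P).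
Proof.
  extensionality i; extensionality j. unfold mat_sub, mat_mul.
  rewrite csum_opp, <- csum_add. apply csum_ext; intros; cring.
Qed.

Lemma mat_mul_sub_r k M N P :
  mat_mul k P (mat_sub M N) = mat_sub (mat_mul k P M) (mat_mul k P N).
Proof.
  extensionality i; extensionality j. unfold mat_sub, mat_mul.
  rewrite csum_opp, <- csum_add. apply csum_ext; intros; cring.
Qed.

Lemma mat_adj_sub M N : mat_adj (mat_sub M N) = mat_sub (mat_adj M) (mat_adj N).
Proof. extensionality i; extensionality j. unfold mat_adj, mat_sub. cring. Qed.

Lemma mat_eqk_refl k M : mat_eqk k M M.
Proof. intros i j _ _; reflexivity. Qed.

Lemma mat_eqk_trans k M N P : mat_eqk k M N -> mat_eqk k N P -> mat_eqk k M P.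
Proof. intros H H' i j Hi Hj. rewrite H, H'; auto. Qed.

Lemma mat_eqk_mul k M M' N N' : mat_eqk k M M' -> mat_eqk k N N' ->
  mat_eqk k (mat_mul k M N) (mat_mul k M' N').
Proof. intros H H' i j Hi Hj. apply csum_ext; intros. rewrite H, H'; auto. Qed.

Lemma mat_mul_1_l k M : mat_eqk k (mat_mul k (mat_scal k C1) M) M.
Proof. intros i j Hi Hj. apply (mat_vec_1 k (fun l => M l j)); auto. Qed.

Lemma mat_adj_1 k : mat_adj (mat_scal k C1) = mat_scal k C1.
Proof.
  extensionality i; extensionality j. unfold mat_adj, mat_scal.
  destruct (Nat.ltb_spec j k), (Nat.ltb_spec i k); simpl;
    destruct (Nat.eqb_spec i j), (Nat.eqb_spec j i); subst; simpl; try lia; cring.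
Qed.

Lemma mat_mul_1_r k M : mat_eqk k (mat_mul k M (mat_scal k C1)) M.
Proof.
  intros i j Hi Hj. rewrite <- (mat_adj_adj (mat_mul k M _)), mat_adj_mul, mat_adj_1.
  unfold mat_adj at 1. rewrite mat_mul_1_l by auto. unfold mat_adj. cring.
Qed.

(** Leaves out the support condition of [unitary], so that closure under products and adjoints
    concerns only entries with indices below [k]. *)
Definition unitary_on (k : nat) (U : Mat) : Prop :=
  mat_eqk k (mat_mul k U (mat_adj U)) (mat_scal k C1) /\
  mat_eqk k (mat_mul k (mat_adj U) U) (mat_scal k C1).

Lemma unitary_on_adj k U : unitary_on k U -> unitary_on k (mat_adj U).
Proof. unfold unitary_on. rewrite mat_adj_adj. tauto. Qed.

Lemma cancel_inner k U V P : mat_eqk k (mat_mul k U V) (mat_scal k C1) ->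
  mat_eqk k (mat_mul k U (mat_mul k V P)) P.
Proof.
  intros H. rewrite <- mat_mul_assoc.
  eapply mat_eqk_trans; [apply mat_eqk_mul; [apply H | apply mat_eqk_refl]|]. apply mat_mul_1_l.
Qed.

Lemma unitary_on_mul k U V : unitary_on k U -> unitary_on k V -> unitary_on k (mat_mul k U V).
Proof.
  intros [H1 H2] [H3 H4]. split; rewrite mat_adj_mul, mat_mul_assoc.
  - eapply mat_eqk_trans; [|apply H1]. apply mat_eqk_mul; [apply mat_eqk_refl|].
    apply cancel_inner; auto.
  - eapply mat_eqk_trans; [|apply H4]. apply mat_eqk_mul; [apply mat_eqk_refl|].
    apply cancel_inner; auto.
Qed.

Lemma unitary_on_op_bounded k U : unitary_on k U -> op_bounded k U 1.
Proof.
  intros [_ H] v. rewrite Rmult_1_l. apply sq_le_inv; [apply vnorm_nonneg|].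
  rewrite <- !re_dot_self, re_dot_adj, <- mat_vec_mul. right. apply re_dot_ext; auto.
  intros i Hi. rewrite <- (mat_vec_1 k v i Hi). apply mat_vec_ext; auto.
Qed.

Lemma fnorm_unitary_on k U : unitary_on k U -> fnorm k U <= sqrt (INR k).
Proof.
  intros HU. rewrite <- (fnorm_ext k _ _ (mat_mul_1_r k U)).
  eapply Rle_trans; [apply fnorm_mul_l with (c := 1); [lra | apply unitary_on_op_bounded; auto]|].
  rewrite Rmult_1_l. unfold fnorm.
  replace (sqrt (INR k)) with (nrm k (fun _ => 1)).
  2:{ unfold nrm. rewrite rsum_const. f_equal; ring. }
  apply nrm_le. intros j Hj. split; [apply vnorm_nonneg|].
  apply nrm_le_of_sq; [lra|].
  rewrite (rsum_ext k _ (fun i => CRe (Cmul (if Nat.eqb j i then C1 else C0) (mkC 1 0)))).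
  - rewrite <- CRe_csum, csum_delta by auto. simpl. lra.
  - intros i Hi. unfold mat_scal. apply Nat.ltb_lt in Hi. rewrite Hi. simpl andb.
    destruct (Nat.eqb_spec i j), (Nat.eqb_spec j i); subst; try lia; rewrite Cmod_sq; simpl; ring.
Qed.

(* For unitaries [U], [U'] and [D = U - U'] one has [D* U + U'* D = 0], so near
   a unitary [V] the self-adjoint part of [V* D] is small compared with [D]
   and its skew part controls [D]: the unitary group has real dimension [k^2]. *)
Lemma unitary_chart k U U' V : unitary_on k U -> unitary_on k U' -> unitary_on k V ->
  op_bounded k (mat_sub U V) (1 / 4) -> op_bounded k (mat_sub U' V) (1 / 4) ->
  let S U := mat_sub (mat_mul k (mat_adj V) U) (mat_mul k (mat_adj U) V) in
  fnorm k (mat_sub U U') <= fnorm k (mat_sub (S U) (S U')).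
Proof.
  intros HU HU' HV H H' S. set (D := mat_sub U U').
  assert (HD : fnorm k D <= fnorm k (mat_mul k (mat_adj V) D)).
  { rewrite <- (fnorm_ext k _ _ (cancel_inner k V (mat_adj V) D (proj1 HV))).
    rewrite <- (Rmult_1_l (fnorm k (mat_mul k (mat_adj V) D))).
    apply fnorm_mul_l; [lra | apply unitary_on_op_bounded; auto]. }
  set (G := mat_mul k (mat_adj V) D) in *.
  assert (Hskew : mat_eqk k (mat_add G (mat_adj G))
    (mat_add (mat_mul k (mat_adj (mat_sub V U')) D) (mat_mul k (mat_adj D) (mat_sub V U)))).
  { intros i j Hi Hj. destruct HU as [_ HU], HU' as [_ HU'].
    unfold G, D. rewrite mat_adj_mul, mat_adj_adj.
    rewrite !mat_adj_sub, !mat_mul_sub_l, !mat_mul_sub_r.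
    unfold mat_add, mat_sub.
    rewrite ?HU, ?HU' by auto. cring. }
  assert (Hs : fnorm k (mat_add G (mat_adj G)) <= 1 / 2 * fnorm k D).
  { rewrite (fnorm_ext k _ _ Hskew). eapply Rle_trans; [apply fnorm_add|].
    assert (Hsub : forall W, op_bounded k (mat_sub W V) (1 / 4) -> op_bounded k (mat_sub V W) (1 / 4)).
    { intros W HW v. eapply Rle_trans; [|apply (HW v)]. right.
      rewrite !vnorm_nrm. apply nrm_ext; intros. rewrite <- Cmod_opp. f_equal.
      unfold mat_vec. rewrite csum_opp. apply csum_ext; intros. unfold mat_sub. cring. }
    assert (fnorm k (mat_mul k (mat_adj (mat_sub V U')) D) <= 1 / 4 * fnorm k D).
    { apply fnorm_mul_l; [lra|]. apply op_bounded_adj; [lra|]. auto. }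
    assert (fnorm k (mat_mul k (mat_adj D) (mat_sub V U)) <= 1 / 4 * fnorm k D).
    { rewrite <- (fnorm_adj k D). apply fnorm_mul_r; [lra|]. auto. }
    lra. }
  assert (H2 : fnorm k (mat_add G G) <= fnorm k (mat_sub G (mat_adj G)) + fnorm k (mat_add G (mat_adj G))).
  { eapply Rle_trans; [|apply fnorm_add]. right. apply fnorm_ext. intros i j _ _.
    unfold mat_add, mat_sub. cring. }
  assert (H3 : 2 * fnorm k G = fnorm k (mat_add G G)).
  { unfold fnorm. rewrite <- nrm_scal by lra. apply nrm_ext; intros j _.
    rewrite <- (Cmod_real 2) by lra. rewrite <- vnorm_smul. apply vnorm_ext; intros.
    unfold mat_add. cring. }
  assert (H4 : mat_sub G (mat_adj G) = mat_sub (S U) (S U')).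
  { unfold G, D, S. rewrite mat_adj_mul, mat_adj_adj, mat_adj_sub, mat_mul_sub_l, mat_mul_sub_r.
    extensionality i; extensionality j. unfold mat_sub. cring. }
  (* Altogether 2 |D| <= 2 |G| <= |S U - S U'| + |D| / 2, and the resulting factor 2/3 is weakened
     to 1. *)
  rewrite <- H4. generalize (fnorm_nonneg k D) (fnorm_nonneg k (mat_sub G (mat_adj G))). lra.
Qed.

Lemma fnorm_conj_sub k W V b r : 0 <= r -> unitary_on k W -> unitary_on k V -> op_bounded k b r ->
  fnorm k (mat_sub (mat_mul k (mat_mul k W b) (mat_adj W)) (mat_mul k (mat_mul k V b) (mat_adj V)))
  <= 2 * r * fnorm k (mat_sub W V).
Proof.
  intros Hr HW HV Hb.
  replace (mat_sub _ _) with
    (mat_add (mat_mul k (mat_mul k (mat_sub W V) b) (mat_adj W))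
             (mat_mul k (mat_mul k V b) (mat_adj (mat_sub W V)))).
  2:{ rewrite mat_adj_sub, !mat_mul_sub_l, !mat_mul_sub_r.
      extensionality i; extensionality j. unfold mat_add, mat_sub. cring. }
  eapply Rle_trans; [apply fnorm_add|].
  assert (fnorm k (mat_mul k (mat_mul k (mat_sub W V) b) (mat_adj W)) <= r * fnorm k (mat_sub W V)).
  { eapply Rle_trans; [apply fnorm_mul_r with (c := 1); [lra | apply unitary_on_op_bounded, unitary_on_adj; auto]|].
    rewrite Rmult_1_l. apply fnorm_mul_r; auto. }
  assert (fnorm k (mat_mul k (mat_mul k V b) (mat_adj (mat_sub W V))) <= r * fnorm k (mat_sub W V)).
  { rewrite mat_mul_assoc.
    eapply Rle_trans; [apply fnorm_mul_l with (c := 1); [lra | apply unitary_on_op_bounded; auto]|].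
    rewrite Rmult_1_l, <- (fnorm_adj k (mat_sub W V)). apply fnorm_mul_l; auto. }
  lra.
Qed.

(** * Covering estimates *)

(* [S] is a union of at most [N] pieces, any two elements of one piece being
   related by [Rl]; no centres are involved, so this passes to subsets. *)
Definition covered {X} (S : X -> Prop) (Rl : X -> X -> Prop) (N : R) : Prop :=
  exists cs : list (X -> Prop), INR (length cs) <= N /\
    (forall a, S a -> exists c, In c cs /\ c a) /\
    (forall c a b, In c cs -> S a -> S b -> c a -> c b -> Rl a b).

Lemma covered_mono {X} (S S' : X -> Prop) (Rl Rl' : X -> X -> Prop) N N' :
  (forall a, S' a -> S a) -> (forall a b, S' a -> S' b -> Rl a b -> Rl' a b) -> N <= N' ->
  covered S Rl N -> covered S' Rl' N'.
Proof.
  intros HS HR HN (cs & Hl & Hc & Hp). exists cs. split; [lra|]. split; eauto.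
Qed.

Lemma covered_preimage {X Y} (f : X -> Y) (S : X -> Prop) (T : Y -> Prop) Rl N :
  (forall a, S a -> T (f a)) -> covered T Rl N -> covered S (fun a b => Rl (f a) (f b)) N.
Proof.
  intros Hf (cs & Hl & Hc & Hp). exists (map (fun c a => c (f a)) cs).
  rewrite length_map. split; [auto|]. split.
  - intros a Ha. destruct (Hc _ (Hf a Ha)) as (c & Hin & Hca).
    exists (fun a => c (f a)). split; auto. apply in_map_iff; eauto.
  - intros c a b Hc' Ha Hb Hca Hcb. apply in_map_iff in Hc'.
    destruct Hc' as (c' & <- & Hin). eauto.
Qed.

(** The second covering may depend on the piece. Each piece is handed over with an element, which
    later serves as base point of a chart, of an orbit or of a translation. *)
Lemma covered_refine {X} (S : X -> Prop) (R1 R2 : X -> X -> Prop) N1 N2 :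
  0 <= N2 -> covered S R1 N1 ->
  (forall S' : X -> Prop, (exists a, S' a) -> (forall a, S' a -> S a) ->
     (forall a b, S' a -> S' b -> R1 a b) -> covered S' R2 N2) ->
  covered S R2 (N1 * N2).
Proof.
  intros HN (cs & Hl & Hc & Hp) Hr.
  assert (H : exists ds : list (X -> Prop), INR (length ds) <= INR (length cs) * N2 /\
    (forall c a, In c cs -> S a -> c a -> exists d, In d ds /\ d a) /\
    (forall d a b, In d ds -> S a -> S b -> d a -> d b -> R2 a b)).
  { clear Hl Hc. induction cs as [|c cs IH].
    - exists nil. simpl. split; [lra|]. split; intros; tauto.
    - destruct IH as (ds & Hdl & Hdc & Hdp); [intros; eapply Hp; eauto; right; auto|].
      destruct (classic (exists a, S a /\ c a)) as [Hne|Hne].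
      + destruct (Hr (fun a => S a /\ c a)) as (es & Hel & Hec & Hep); [auto|tauto| |].
        { intros a b [Ha Hca] [Hb Hcb]. apply (Hp c); auto. left; auto. }
        exists (map (fun e a => e a /\ c a) es ++ ds).
        rewrite length_app, length_map, plus_INR. simpl length. rewrite S_INR. split; [lra|]. split.
        * intros c' a [<-|Hin] Ha Hca.
          -- destruct (Hec a (conj Ha Hca)) as (e & He & Hea).
             exists (fun a => e a /\ c a). split; auto. apply in_or_app; left.
             apply in_map_iff; eauto.
          -- destruct (Hdc c' a Hin Ha Hca) as (d & Hd & Hda). exists d.
             split; auto. apply in_or_app; auto.
        * intros d a b Hd Ha Hb Hda Hdb. apply in_app_or in Hd. destruct Hd as [Hd|Hd]; eauto.
          apply in_map_iff in Hd. destruct Hd as (e & <- & He). destruct Hda, Hdb.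
          apply (Hep e); auto.
      + exists ds. simpl length. rewrite S_INR. split; [lra|]. split; auto.
        intros c' a [<-|Hin] Ha Hca; eauto. exfalso; eauto. }
  destruct H as (ds & Hdl & Hdc & Hdp). exists ds. split.
  - assert (INR (length cs) * N2 <= N1 * N2) by (apply Rmult_le_compat_r; auto). lra.
  - split; auto. intros a Ha. destruct (Hc a Ha) as (c & Hin & Hca). eauto.
Qed.

Lemma covered_all_lt {X} (S : X -> Prop) (Rl : nat -> X -> X -> Prop) N n : 0 <= N ->
  (forall i, (i < n)%nat -> covered S (Rl i) N) ->
  covered S (fun a b => forall i, (i < n)%nat -> Rl i a b) (N ^ n).
Proof.
  intros HN. induction n; intros H.
  - exists ((fun _ => True) :: nil). simpl. split; [lra|]. split.
    + intros; exists (fun _ => True); auto.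
    + intros; lia.
  - rewrite <- tech_pow_Rmult, Rmult_comm.
    apply covered_refine with (fun a b => forall i, (i < n)%nat -> Rl i a b); auto.
    intros S' _ HS' Hr. eapply covered_mono; [exact HS'| |apply Rle_refl|apply (H n); lia].
    intros a b Ha Hb Hn i Hi. destruct (Nat.eq_dec i n) as [->|]; auto. apply Hr; auto; lia.
Qed.

(** * Coverings obtained from lattice points *)

Lemma lattice_covered N m : (1 <= m)%nat ->
  covered (fun z : nat -> Z => rsum N (fun j => Rabs (IZR (z j))) <= INR N * INR m)
    (fun z z' => forall j, (j < N)%nat -> z j = z' j) ((8 * INR m) ^ N).
Proof.
  intros Hm. exists (map (fun p z => forall j, (j < N)%nat -> p j = z j) (l1_points N (N * m))).
  rewrite length_map. split; [apply l1_points_card; auto|]. split.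
  - intros z Hz. rewrite <- mult_INR in Hz.
    destruct (l1_points_complete N (N * m) z Hz) as (p & Hp & Hpz).
    exists (fun z => forall j, (j < N)%nat -> p j = z j). split; auto. apply in_map_iff; eauto.
  - intros c a b Hc _ _ Ha Hb j Hj. apply in_map_iff in Hc. destruct Hc as (p & <- & _).
    rewrite <- Ha, <- Hb; auto.
Qed.

Definition flat (k : nat) (Y : nat -> nat -> R) : nat -> R := fun t => Y (t / k)%nat (t mod k)%nat.

Lemma rsum_flat k (Y : nat -> nat -> R) :
  rsum (k * k) (flat k Y) = rsum k (fun i => rsum k (Y i)).
Proof.
  rewrite rsum_flatten. apply rsum_ext; intros i Hi. apply rsum_ext; intros j Hj.
  unfold flat. rewrite div_flat, mod_flat; auto.
Qed.

Lemma nrm_flat_le_fnorm k (Y : nat -> nat -> R) M :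
  (forall i j, Y i j ^ 2 <= Cmod (M i j) ^ 2) -> nrm (k * k) (flat k Y) <= fnorm k M.
Proof.
  intros H. apply nrm_le_of_sq; [apply fnorm_nonneg|].
  change (fun i => flat k Y i ^ 2) with (flat k (fun i j => Y i j ^ 2)).
  rewrite rsum_flat, fnorm_sq, rsum_swap. apply rsum_le; intros. apply rsum_le; auto.
Qed.

Lemma sqrt_INR_mul k : sqrt (INR (k * k)) = INR k.
Proof. rewrite mult_INR. apply sqrt_square, pos_INR. Qed.

Lemma nrm_neg k u : nrm k (fun i => -1 * u i) = nrm k u.
Proof. unfold nrm. f_equal. apply rsum_ext; intros; ring. Qed.

(** Spacing sigma / sqrt k turns a rounding error of order sqrt k into one of order sigma. In these
    units the matrices in question have l1 norm at most k^2 rho / sigma, and rounding adds at most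
    k^2; this is the condition on [m]. *)
Lemma real_bil_covered : exists Cr, 0 < Cr /\ forall k m rho sigma, (1 <= k)%nat -> 0 <= rho ->
  0 < sigma -> 1 + rho / sigma <= INR m ->
  covered (fun Y => nrm (k * k) (flat k Y) <= sqrt (INR k) * rho)
    (fun Y Y' => forall u v, bil k (fun i j => Y i j - Y' i j) u v
                             <= Cr * sigma * nrm k u * nrm k v)
    ((8 * INR m) ^ (k * k)).
Proof.
  destruct integer_rounding_bil as (Cr & HCr & Hround).
  exists (2 * Cr). split; [lra|]. intros k m rho sigma Hk Hrho Hsigma Hm.
  assert (Hq := sqrt_INR_pos k Hk). assert (Hqq := sqrt_INR_sq k).
  set (q := sqrt (INR k)) in *. set (s := sigma / q).
  assert (Hs : 0 < s) by (apply Rdiv_lt_0_compat; auto).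
  assert (Hm1 : (1 <= m)%nat).
  { apply INR_le. simpl. assert (0 <= rho / sigma); [|lra].
    apply Rmult_le_pos; auto. left; apply Rinv_0_lt_compat; auto. }
  set (good (z : nat -> Z) (Y : nat -> nat -> R) := forall u v,
    bil k (fun i j => Y i j / s - IZR (z (i * k + j)%nat)) u v <= Cr * q * nrm k u * nrm k v).
  exists (map good (l1_points (k * k) (k * k * m))). rewrite length_map.
  split; [apply l1_points_card; auto|]. split.
  - intros Y HY. destruct (Hround k (fun i j => Y i j / s) Hk) as (Z & HZ1 & HZ2).
    set (z t := Z (t / k)%nat (t mod k)%nat).
    destruct (l1_points_complete (k * k) (k * k * m) z) as (z' & Hz' & Hzz').
    { change (fun j => Rabs (IZR (z j))) with (flat k (fun i j => Rabs (IZR (Z i j)))).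
      rewrite rsum_flat.
      apply Rle_trans with (rsum k (fun i => rsum k (fun j => / s * Rabs (Y i j) + 1))).
      { apply rsum_le; intros i Hi. apply rsum_le; intros j Hj.
        specialize (HZ1 i j Hi Hj).
        replace (/ s * Rabs (Y i j)) with (Rabs (Y i j / s)).
        - revert HZ1. generalize (Y i j / s) (IZR (Z i j)). intros a b.
          unfold Rabs; repeat destruct Rcase_abs; lra.
        - unfold Rdiv. rewrite Rabs_mult, (Rabs_pos_eq (/ s)); [ring|].
          left; apply Rinv_0_lt_compat; auto. }
      change (rsum k (fun i => rsum k ((fun i j => / s * Rabs (Y i j) + 1) i))
              <= INR (k * k * m)).
      rewrite <- rsum_flat. unfold flat. rewrite rsum_plus, rsum_scal, rsum_const.
      generalize (rsum_abs_le (k * k) (flat k Y)). rewrite sqrt_INR_mul. unfold flat in *.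
      intros Hsum. rewrite !mult_INR.
      assert (Hsq : / s * (q * rho) = INR k * (rho / sigma)).
      { unfold s. rewrite <- Hqq. field. lra. }
      assert (Hsi : 0 < / s) by (apply Rinv_0_lt_compat; auto).
      assert (Hki : 0 <= INR k) by apply pos_INR.
      set (X := rsum (k * k) (fun i => Rabs (Y (i / k)%nat (i mod k)%nat))) in *.
      assert (HX : X <= INR k * (q * rho)) by (eapply Rle_trans; [apply Hsum|]; nra).
      assert (/ s * X <= / s * (INR k * (q * rho))) by (apply Rmult_le_compat_l; lra).
      assert (INR k * INR k * (1 + rho / sigma) <= INR k * INR k * INR m).
      { apply Rmult_le_compat_l; [nra|auto]. }
      replace (/ s * (INR k * (q * rho))) with (INR k * (/ s * (q * rho))) in H by ring.
      rewrite Hsq in H. lra. }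
    exists (good z'). split; [apply in_map; auto|]. intros u v.
    eapply Rle_trans; [|apply HZ2]. right. apply rsum_ext; intros i Hi.
    apply rsum_ext; intros j Hj. rewrite Hzz' by nia. unfold z.
    rewrite div_flat, mod_flat by auto. reflexivity.
  - intros c Y Y' Hc _ _ HY HY' u v. apply in_map_iff in Hc. destruct Hc as (z & <- & _).
    (* The error of [Y'] enters with the opposite sign, which is obtained by evaluating its bound at
       -u. *)
    generalize (HY u v) (HY' (fun i => -1 * u i) (fun j => 1 * v j)).
    rewrite bil_scal, nrm_neg, (nrm_ext k (fun i => 1 * v i) v) by (intros; ring). intros H1 H2.
    assert (E : bil k (fun i j => Y i j - Y' i j) u v
      = s * (bil k (fun i j => Y i j / s - IZR (z (i * k + j)%nat)) u v
         + -1 * 1 * bil k (fun i j => Y' i j / s - IZR (z (i * k + j)%nat)) u v)).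
    { unfold bil. rewrite <- rsum_scal, <- rsum_plus, <- rsum_scal.
      apply rsum_ext; intros. rewrite <- rsum_scal, <- rsum_plus, <- rsum_scal.
      apply rsum_ext; intros. field. lra. }
    rewrite E.
    replace (2 * Cr * sigma * nrm k u * nrm k v)
      with (s * (Cr * q * nrm k u * nrm k v + Cr * q * nrm k u * nrm k v))
      by (unfold s; field; lra).
    apply Rmult_le_compat_l; lra.
Qed.

(** Pairing E v with itself gives four real forms in the real and imaginary parts of E v and v, each
    at most K |E v| |v|; dividing by |E v| leaves 4 K. *)
Lemma op_bounded_of_bil k E K : 0 <= K ->
  (forall u v, bil k (fun i j => CRe (E i j)) u v <= K * nrm k u * nrm k v) ->
  (forall u v, bil k (fun i j => CIm (E i j)) u v <= K * nrm k u * nrm k v) ->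
  op_bounded k E (4 * K).
Proof.
  intros HK HR HI v. set (w := mat_vec k E v).
  assert (HRe : forall x, nrm k (fun i => CRe (x i)) <= vnorm k x).
  { intros x. rewrite <- nrm_abs, vnorm_nrm. apply nrm_le; intros. split; [apply Rabs_pos|].
    apply sq_le_inv; [apply Cmod_nonneg|]. rewrite pow2_abs, Cmod_sq.
    generalize (pow2_ge_0 (CIm (x i))); lra. }
  assert (HIm : forall x, nrm k (fun i => CIm (x i)) <= vnorm k x).
  { intros x. rewrite <- nrm_abs, vnorm_nrm. apply nrm_le; intros. split; [apply Rabs_pos|].
    apply sq_le_inv; [apply Cmod_nonneg|]. rewrite pow2_abs, Cmod_sq.
    generalize (pow2_ge_0 (CRe (x i))); lra. }
  assert (Edot : re_dot k w w =
      bil k (fun i j => CRe (E i j)) (fun i => CRe (w i)) (fun i => CRe (v i))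
    + (bil k (fun i j => CIm (E i j)) (fun i => -1 * CRe (w i)) (fun i => CIm (v i))
    + (bil k (fun i j => CRe (E i j)) (fun i => CIm (w i)) (fun i => CIm (v i))
    + bil k (fun i j => CIm (E i j)) (fun i => CIm (w i)) (fun i => CRe (v i))))).
  { unfold bil. rewrite <- !rsum_plus. apply rsum_ext; intros i Hi.
    rewrite <- !rsum_plus. unfold w at 1 3. unfold mat_vec. rewrite CRe_csum, CIm_csum.
    rewrite (Rmult_comm _ (CRe (w i))), (Rmult_comm _ (CIm (w i))).
    rewrite <- !rsum_scal, <- rsum_plus. apply rsum_ext; intros; simpl; ring. }
  assert (Hb : forall a b, 0 <= a <= vnorm k w -> 0 <= b <= vnorm k v ->
    K * a * b <= K * vnorm k w * vnorm k v).
  { intros a b Ha Hb. rewrite !Rmult_assoc. apply Rmult_le_compat_l; auto.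
    apply Rmult_le_compat; lra. }
  assert (Hneg : nrm k (fun i => -1 * CRe (w i)) = nrm k (fun i => CRe (w i))).
  { apply nrm_neg. }
  assert (Hsq : vnorm k w ^ 2 <= 4 * K * vnorm k w * vnorm k v).
  { rewrite <- re_dot_self, Edot.
    generalize (HR (fun i => CRe (w i)) (fun i => CRe (v i)))
      (HI (fun i => -1 * CRe (w i)) (fun i => CIm (v i)))
      (HR (fun i => CIm (w i)) (fun i => CIm (v i)))
      (HI (fun i => CIm (w i)) (fun i => CRe (v i))).
    rewrite Hneg.
    generalize (Hb _ _ (conj (nrm_nonneg k _) (HRe w)) (conj (nrm_nonneg k _) (HRe v)))
      (Hb _ _ (conj (nrm_nonneg k _) (HRe w)) (conj (nrm_nonneg k _) (HIm v)))
      (Hb _ _ (conj (nrm_nonneg k _) (HIm w)) (conj (nrm_nonneg k _) (HIm v)))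
      (Hb _ _ (conj (nrm_nonneg k _) (HIm w)) (conj (nrm_nonneg k _) (HRe v))).
    lra. }
  destruct (Rle_lt_or_eq_dec 0 _ (vnorm_nonneg k w)) as [Hw|Hw].
  - apply Rmult_le_reg_r with (vnorm k w); auto. lra.
  - rewrite <- Hw. generalize (vnorm_nonneg k v); intro. nra.
Qed.

(** Real and imaginary parts are cut one after the other, hence the square. Only the ratio of [rho]
    to [sigma] enters the count, so cutting a ball into pieces of comparable radius costs a constant
    to the power k^2. *)
Lemma op_covered : exists Co, 0 < Co /\ forall k m rho sigma, (1 <= k)%nat -> 0 <= rho ->
  0 < sigma -> 1 + rho / sigma <= INR m ->
  covered (fun M => fnorm k M <= sqrt (INR k) * rho)
    (fun M M' => op_bounded k (mat_sub M M') (Co * sigma)) (((8 * INR m) ^ 2) ^ (k * k)).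
Proof.
  destruct real_bil_covered as (Cr & HCr & Hcov).
  exists (4 * Cr). split; [lra|]. intros k m rho sigma Hk Hrho Hsigma Hm.
  specialize (Hcov k m rho sigma Hk Hrho Hsigma Hm).
  replace (((8 * INR m) ^ 2) ^ (k * k)) with ((8 * INR m) ^ (k * k) * (8 * INR m) ^ (k * k)).
  2:{ rewrite <- Rpow_mult_distr. f_equal. ring. }
  set (Rre := fun M M' : Mat => forall u v,
    bil k (fun i j => CRe (M i j) - CRe (M' i j)) u v <= Cr * sigma * nrm k u * nrm k v).
  apply covered_refine with Rre.
  - apply pow_le. generalize (pos_INR m); lra.
  - refine (covered_preimage (fun (M : Mat) i j => CRe (M i j)) _ _ _ _ _ Hcov).
    intros M HM. eapply Rle_trans; [apply nrm_flat_le_fnorm|apply HM].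
    intros. rewrite Cmod_sq. generalize (pow2_ge_0 (CIm (M i j))); lra.
  - intros S' _ HS' Hre.
    apply covered_mono with S' (fun M M' : Mat => forall u v,
      bil k (fun i j => CIm (M i j) - CIm (M' i j)) u v <= Cr * sigma * nrm k u * nrm k v)
      ((8 * INR m) ^ (k * k)); auto; [|lra|].
    + intros M M' HM HM' Him.
      replace (4 * Cr * sigma) with (4 * (Cr * sigma)) by ring.
      apply op_bounded_of_bil; [nra| |]; intros u v.
      * apply (Hre M M' HM HM' u v).
      * apply (Him u v).
    + refine (covered_preimage (fun (M : Mat) i j => CIm (M i j)) _ _ _ _ _ Hcov).
      intros M HM. eapply Rle_trans; [apply nrm_flat_le_fnorm|apply (HS' _ HM)].
      intros. rewrite Cmod_sq. generalize (pow2_ge_0 (CRe (M i j))); lra.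
Qed.

Definition skew (k : nat) (K : Mat) : Prop :=
  forall i j, (i < k)%nat -> (j < k)%nat -> K i j = Copp (Cconj (K j i)).

(* A skew-adjoint matrix is determined by [k^2] real coordinates: the real
   parts above the diagonal and the imaginary parts on and below it. *)
Lemma skew_covered k m rho sigma : (1 <= k)%nat -> 0 <= rho -> 0 < sigma ->
  1 + rho / sigma <= INR m ->
  covered (fun K => skew k K /\ fnorm k K <= sqrt (INR k) * rho)
    (fun K K' => fnorm k (mat_sub K K') <= sqrt (INR k) * (2 * sigma)) ((8 * INR m) ^ (k * k)).
Proof.
  intros Hk Hrho Hsigma Hm.
  assert (Hq := sqrt_INR_pos k Hk). assert (Hqq := sqrt_INR_sq k).
  set (q := sqrt (INR k)) in *. set (s := sigma / q).
  assert (Hs : 0 < s) by (apply Rdiv_lt_0_compat; auto).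
  assert (Hm1 : (1 <= m)%nat).
  { apply INR_le. simpl. assert (0 <= rho / sigma); [|lra].
    apply Rmult_le_pos; auto. left; apply Rinv_0_lt_compat; auto. }
  set (y (K : Mat) i j := if Nat.ltb i j then CRe (K i j) else CIm (K i j)).
  set (z (K : Mat) t := (up (flat k (y K) t / s) - 1)%Z).
  eapply covered_mono; [| |apply Rle_refl|
    refine (covered_preimage z (fun K => skew k K /\ fnorm k K <= q * rho) _ _ _ _
              (lattice_covered (k * k) m Hm1))].
  - auto.
  - intros K K' [HK _] [HK' _] Hz.
    assert (Hy : forall i j, (i < k)%nat -> (j < k)%nat -> Rabs (y K i j - y K' i j) <= s).
    { intros i j Hi Hj. specialize (Hz (i * k + j)%nat ltac:(nia)). simpl in Hz.
      unfold z, flat in Hz. rewrite !div_flat, !mod_flat in Hz by auto.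
      generalize (archimed (y K i j / s)) (archimed (y K' i j / s)).
      replace (up (y K i j / s)) with (up (y K' i j / s)) by lia. intros.
      replace (y K i j - y K' i j) with (s * (y K i j / s - y K' i j / s)) by (field; lra).
      apply Rabs_le. nra. }
    assert (Hent : forall i j, (i < k)%nat -> (j < k)%nat ->
      Rabs (CRe (mat_sub K K' i j)) <= s /\ Rabs (CIm (mat_sub K K' i j)) <= s).
    { intros i j Hi Hj. generalize (Hy i j Hi Hj) (Hy j i Hj Hi).
      generalize (f_equal CRe (HK i j Hi Hj)) (f_equal CIm (HK i j Hi Hj))
        (f_equal CRe (HK' i j Hi Hj)) (f_equal CIm (HK' i j Hi Hj)).
      unfold y, mat_sub. simpl. intros E1 E2 E3 E4.
      destruct (Nat.ltb_spec i j), (Nat.ltb_spec j i); try lia.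
      - intros. rewrite E2, E4. split; [auto|].
        match goal with |- Rabs ?e <= _ => replace e with (CIm (K j i) - CIm (K' j i)) by ring end.
        auto.
      - intros. rewrite E1, E3. split; [|auto].
        rewrite <- Rabs_Ropp.
        match goal with |- Rabs ?e <= _ => replace e with (CRe (K j i) - CRe (K' j i)) by ring end.
        auto.
      - assert (i = j) by lia. subst j. intros. split; [|auto].
        replace (CRe (K i i) + - CRe (K' i i)) with 0 by lra. rewrite Rabs_R0; lra. }
    apply sq_le_inv; [nra|]. rewrite fnorm_sq.
    (* Each entry contributes at most 2 s^2 with s = sigma / sqrt k; the total 2 k sigma^2 is below
       k (2 sigma)^2. *)
    apply Rle_trans with (rsum k (fun _ => rsum k (fun _ => 2 * s ^ 2))).
    + apply rsum_le; intros j Hj. apply rsum_le; intros i Hi.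
      destruct (Hent i j Hi Hj) as [H1 H2]. rewrite Cmod_sq.
      rewrite <- (pow2_abs (CRe _)), <- (pow2_abs (CIm _)).
      generalize (Rabs_pos (CRe (mat_sub K K' i j))) (Rabs_pos (CIm (mat_sub K K' i j))). nra.
    + rewrite !rsum_const, <- Hqq. unfold s.
      replace (q * q * (q * q * (2 * (sigma / q) ^ 2))) with (2 * (q * q) * sigma ^ 2)
        by (field; lra). nra.
  - intros K [_ HK]. unfold z. eapply Rle_trans; [apply floor_le_sq_sum; auto|].
    rewrite sqrt_INR_mul, mult_INR.
    assert (Hf : nrm (k * k) (flat k (y K)) <= q * rho).
    { eapply Rle_trans; [apply nrm_flat_le_fnorm|apply HK]. intros i j. rewrite Cmod_sq.
      generalize (pow2_ge_0 (CIm (K i j))) (pow2_ge_0 (CRe (K i j))). unfold y.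
      destruct Nat.ltb; lra. }
    assert (Hsi : 0 < / s) by (apply Rinv_0_lt_compat; auto).
    assert (H : nrm (k * k) (flat k (y K)) / s <= INR k * (rho / sigma)).
    { replace (INR k * (rho / sigma)) with (q * rho / s) by (unfold s; rewrite <- Hqq; field; lra).
      apply Rmult_le_compat_r; lra. }
    assert (0 <= INR k) by apply pos_INR.
    assert (INR k * INR k * (1 + rho / sigma) <= INR k * INR k * INR m).
    { apply Rmult_le_compat_l; [nra|auto]. }
    assert (INR k * (nrm (k * k) (flat k (y K)) / s) <= INR k * (INR k * (rho / sigma)))
      by (apply Rmult_le_compat_l; auto).
    lra.
Qed.

Lemma exists_nat_ge x : 0 <= x -> exists m : nat, x <= INR m <= x + 1.
Proof.
  intros Hx. exists (Z.to_nat (up x)). rewrite INR_IZR_INZ, Z2Nat.id.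
  - generalize (archimed x). lra.
  - apply le_IZR. generalize (archimed x). lra.
Qed.

Lemma unitary_covered : exists Cu, 0 < Cu /\ forall k w, (1 <= k)%nat -> 0 < w <= 1 ->
  covered (unitary_on k) (fun U U' => fnorm k (mat_sub U U') <= sqrt (INR k) * w) ((Cu / w) ^ (k * k)).
Proof.
  destruct op_covered as (Co & HCo & Hop).
  (* [m1] serves rho = 1 and sigma = 1 / (4 Co), for which the pieces have operator norm diameter
     1/4, as the chart requires. *)
  destruct (exists_nat_ge (1 + 1 / (1 / (4 * Co)))) as (m1 & Hm1 & _).
  { replace (1 / (1 / (4 * Co))) with (4 * Co) by (field; lra). lra. }
  assert (Hm1' : 0 < INR m1).
  { replace (1 / (1 / (4 * Co))) with (4 * Co) in Hm1 by (field; lra). lra. }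
  (* The chart takes values in the ball of radius 2 sqrt k, to be cut with sigma = w / 2. So [m2]
     below is at most 2 + 4 / w <= 6 / w, and 48 = 8 * 6. *)
  exists ((8 * INR m1) ^ 2 * 48). split; [nra|]. intros k w Hk Hw.
  assert (Hiw : 1 <= / w) by (rewrite <- Rinv_1; apply Rinv_le_contravar; lra).
  replace ((8 * INR m1) ^ 2 * 48 / w) with ((8 * INR m1) ^ 2 * (48 / w)) by (field; lra).
  rewrite Rpow_mult_distr.
  apply covered_refine with (fun U U' => op_bounded k (mat_sub U U') (1 / 4)).
  - apply pow_le. unfold Rdiv; nra.
  - eapply covered_mono; [| |apply Rle_refl|apply (Hop k m1 1 (1 / (4 * Co))); auto; try lra].
    + intros U HU. rewrite Rmult_1_r. apply fnorm_unitary_on; auto.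
    + intros U U' _ _. replace (Co * (1 / (4 * Co))) with (1 / 4) by (field; lra). auto.
    + apply Rdiv_lt_0_compat; lra.
  - intros S' [V HV] HS' Hclose.
    destruct (exists_nat_ge (1 + 2 / (w / 2))) as (m2 & Hm2 & Hm2').
    { replace (2 / (w / 2)) with (4 * / w) by (field; lra). lra. }
    set (SK := fun U : Mat => mat_sub (mat_mul k (mat_adj V) U) (mat_mul k (mat_adj U) V)).
    eapply covered_mono; [exact (fun a h => h)| | |
      refine (covered_preimage SK S' _ _ _ _ (skew_covered k m2 2 (w / 2) Hk _ _ Hm2)); try lra].
    + intros U U' HU HU' HSK. eapply Rle_trans; [apply (unitary_chart k U U' V); auto|].
      replace w with (2 * (w / 2)) by field. apply HSK.
    + apply pow_incr. split; [generalize (pos_INR m2); lra|].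
      replace (2 / (w / 2)) with (4 * / w) in Hm2' by (field; lra). unfold Rdiv. lra.
    + intros U HU. split.
      * intros i j _ _. unfold SK.
        assert (E : mat_mul k (mat_adj U) V = mat_adj (mat_mul k (mat_adj V) U))
          by (rewrite mat_adj_mul, mat_adj_adj; reflexivity).
        rewrite E. unfold mat_sub, mat_adj. cring.
      * unfold SK.
        assert (Hsub : fnorm k (mat_sub (mat_mul k (mat_adj V) U) (mat_mul k (mat_adj U) V))
          <= fnorm k (mat_mul k (mat_adj V) U) + fnorm k (mat_mul k (mat_adj U) V)).
        { unfold fnorm at 2 3. eapply Rle_trans; [|apply nrm_triangle]. apply nrm_le; intros.
          split; [apply vnorm_nonneg|].
          eapply Rle_trans; [apply (vnorm_triangle k
            (fun i0 => mat_mul k (mat_adj V) U i0 i) (fun i0 => Copp (mat_mul k (mat_adj U) V i0 i)))|].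
          apply Rplus_le_compat_l. right. rewrite !vnorm_nrm. apply nrm_ext; intros; apply Cmod_opp. }
        assert (forall A B, unitary_on k A -> unitary_on k B -> fnorm k (mat_mul k (mat_adj A) B) <= sqrt (INR k)).
        { intros A B HA HB. apply fnorm_unitary_on, unitary_on_mul; auto. apply unitary_on_adj; auto. }
        generalize (H V U (HS' _ HV) (HS' _ HU)) (H U V (HS' _ HU) (HS' _ HV)). lra.
Qed.

Definition mat_conj (k : nat) (W X : Mat) : Mat := mat_mul k (mat_mul k W X) (mat_adj W).

Lemma orbit_covered n R0 : 0 < R0 -> exists Cg, 1 <= Cg /\ forall k w S B,
  (1 <= k)%nat -> 0 < w <= 1 ->
  (forall (a : Tup), S a -> forall i, (i < n)%nat -> op_bounded k (a i) R0) ->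
  covered S (fun a b => exists W, unitary_on k W /\ forall i, (i < n)%nat ->
    fnorm k (mat_sub (a i) (mat_conj k W (b i))) <= sqrt (INR k) * (2 * w)) B ->
  covered S (fun a b => forall i, (i < n)%nat -> op_bounded k (mat_sub (a i) (b i)) (Cg * w))
    (B * (Cg / w) ^ (k * k)).
Proof.
  intros HR0. destruct unitary_covered as (Cu & HCu & Hun).
  destruct op_covered as (Co & HCo & Hop).
  (* Two elements in one piece are each within 2 w of a conjugate of a common [b], and the two
     conjugates are within 2 R0 w of each other, in the normalised 2-norm. *)
  destruct (exists_nat_ge (1 + (4 + 2 * R0))) as (m & Hm & _); [lra|].
  set (c := (8 * INR m) ^ 2). assert (Hc : 0 < c) by (unfold c; nra).
  assert (Hcn : 0 < c ^ n) by (apply pow_lt; auto).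
  (* A single constant dominates both the radius factor [Co] and the base [Cu * c ^ n] of the count;
     the power [n] comes from cutting each component separately. *)
  exists (1 + Co + Cu * c ^ n).
  assert (Hcu : 0 < Cu * c ^ n) by nra.
  split; [lra|]. intros k w S B Hk Hw HS Hcov.
  assert (Hiw : 0 < / w) by (apply Rinv_0_lt_compat; lra).
  apply covered_mono with S (fun a b => forall i, (i < n)%nat -> op_bounded k (mat_sub (a i) (b i)) (Co * w))
    (B * ((Cu / w) ^ (k * k) * (c ^ (k * k)) ^ n)); auto.
  { intros a b _ _ H i Hi. eapply op_bounded_le; [|apply H; auto]. nra. }
  { assert (HB : 0 <= B).
    { destruct Hcov as (cs & Hl & _). generalize (pos_INR (length cs)); lra. }
    apply Rmult_le_compat_l; auto.
    rewrite <- (pow_mult c), (Nat.mul_comm _ n), (pow_mult c), <- Rpow_mult_distr.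
    apply pow_incr. unfold Rdiv. split; [|nra].
    apply Rmult_le_pos; [|lra]. apply Rmult_le_pos; lra. }
  eapply covered_refine; [|apply Hcov|].
  { apply Rmult_le_pos; repeat apply pow_le; [unfold Rdiv; nra | lra]. }
  intros S1 [b Hb] HS1 Horb.
  apply covered_refine with (fun a a' : Tup => forall i, (i < n)%nat ->
    fnorm k (mat_sub (a i) (a' i)) <= sqrt (INR k) * ((4 + 2 * R0) * w)).
  { repeat apply pow_le; lra. }
  - destruct (Hun k w Hk Hw) as (cs & Hl & Hcs & Hp).
    set (near (p : Mat -> Prop) (a : Tup) := exists W, unitary_on k W /\ p W /\ forall i, (i < n)%nat ->
      fnorm k (mat_sub (a i) (mat_conj k W (b i))) <= sqrt (INR k) * (2 * w)).
    exists (map near cs). rewrite length_map. split; [auto|]. split.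
    + intros a Ha. destruct (Horb a b Ha Hb) as (W & HW & Hd).
      destruct (Hcs W HW) as (p & Hin & HpW). exists (near p). split; [apply in_map; auto|].
      exists W; auto.
    + intros c' a a' Hc' Ha Ha' Hca Hca' i Hi. apply in_map_iff in Hc'.
      destruct Hc' as (p & <- & Hin).
      destruct Hca as (W & HW & HpW & Hd), Hca' as (W' & HW' & HpW' & Hd').
      specialize (Hd i Hi). specialize (Hd' i Hi). rewrite fnorm_sub_comm in Hd'.
      assert (Hm' : fnorm k (mat_sub (mat_conj k W (b i)) (mat_conj k W' (b i))) <= sqrt (INR k) * (2 * R0 * w)).
      { eapply Rle_trans; [apply fnorm_conj_sub with (r := R0); auto; lra|].
        generalize (Hp p W W' Hin HW HW' HpW HpW'). nra. }
      replace (mat_sub (a i) (a' i)) with (mat_add (mat_sub (a i) (mat_conj k W (b i)))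
        (mat_add (mat_sub (mat_conj k W (b i)) (mat_conj k W' (b i))) (mat_sub (mat_conj k W' (b i)) (a' i)))).
      2:{ extensionality x; extensionality y. unfold mat_add, mat_sub. cring. }
      generalize (fnorm_add k (mat_sub (a i) (mat_conj k W (b i)))
        (mat_add (mat_sub (mat_conj k W (b i)) (mat_conj k W' (b i))) (mat_sub (mat_conj k W' (b i)) (a' i))))
        (fnorm_add k (mat_sub (mat_conj k W (b i)) (mat_conj k W' (b i))) (mat_sub (mat_conj k W' (b i)) (a' i))).
      lra.
  - intros S2 [a0 Ha0] HS2 Hd. apply covered_all_lt; [apply pow_le; lra|]. intros i Hi.
    (* Translation by [a0] centres the piece at zero, where [op_covered] applies with the ratio 4 +
       2 R0. *)
    eapply covered_mono; [exact (fun a h => h)| |apply Rle_refl|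
      refine (covered_preimage (fun a : Tup => mat_sub (a i) (a0 i)) S2 _ _ _ _
        (Hop k m ((4 + 2 * R0) * w) w Hk _ _ _)); [|nra|lra|]].
    + intros a a' _ _ H. eapply op_bounded_ext; [|exact H].
      intros x y _ _. unfold mat_sub. cring.
    + intros a Ha. apply Hd; auto.
    + unfold Rdiv. rewrite Rmult_assoc, Rinv_r by lra. lra.
Qed.

(** * Extended reals and the entropy inequality *)

(** Covering numbers ask for centres inside the set. Since pieces are controlled pairwise, one point
    of each piece that meets [S] will do. *)
Lemma covered_centers {X} (S : X -> Prop) (Rl : X -> X -> Prop) N : covered S Rl N ->
  exists ds : list X, INR (length ds) <= N /\ (forall d, In d ds -> S d) /\
    (forall a, S a -> exists d, In d ds /\ Rl a d).
Proof.
  intros (cs & Hl & Hc & Hp).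
  assert (H : exists ds : list X, (length ds <= length cs)%nat /\ (forall d, In d ds -> S d) /\
    forall c a, In c cs -> S a -> c a -> exists d, In d ds /\ c d).
  { clear. induction cs as [|c cs (ds & Hl & HS & Hd)].
    - exists nil. simpl. split; [lia|]. split; intros; tauto.
    - destruct (classic (exists a, S a /\ c a)) as [(a & Ha & Hca)|Hne].
      + exists (a :: ds). simpl. split; [lia|]. split.
        * intros d [<-|H]; auto.
        * intros c' b [<-|Hin] Hb Hcb; [exists a; auto|].
          destruct (Hd c' b Hin Hb Hcb) as (d & ? & ?). exists d; auto.
      + exists ds. simpl. split; [lia|]. split; auto.
        intros c' b [<-|Hin] Hb Hcb; eauto. exfalso; eauto. }
  destruct H as (ds & Hlen & HS & Hd). exists ds. split; [|split; auto].
  - apply le_INR in Hlen. lra.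
  - intros a Ha. destruct (Hc a Ha) as (c & Hin & Hca).
    destruct (Hd c a Hin Ha Hca) as (d & Hdin & Hcd). exists d. split; auto.
    apply (Hp c); auto.
Qed.

Lemma Rbar_le_refl x : Rbar_le x x.
Proof. destruct x; simpl; auto; lra. Qed.

Lemma Rbar_le_trans x y z : Rbar_le x y -> Rbar_le y z -> Rbar_le x z.
Proof. destruct x, y, z; simpl; try tauto; lra. Qed.

Lemma Rbar_le_total x y : Rbar_le x y \/ Rbar_le y x.
Proof. destruct x, y; simpl; auto; lra. Qed.

(** Guarantees that the suprema and infima picked by [epsilon] are genuine for every set, with
    -infinity as supremum of the empty set. *)
Lemma Rbar_lub_exists E : exists l, Rbar_is_lub E l.
Proof.
  destruct (classic (E PInf)) as [HP|HP].
  { exists PInf. split; [intros z _; destruct z; simpl; auto|]. intros u Hu. apply (Hu _ HP). }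
  destruct (classic (exists r, E (Finite r))) as [[r Hr]|He].
  - destruct (classic (bound (fun r => E (Finite r)))) as [Hb|Hb].
    + destruct (completeness (fun r => E (Finite r)) Hb (ex_intro _ r Hr)) as [l [H1 H2]].
      exists (Finite l). split.
      * intros [a| |] Ha; simpl; auto.
      * intros [u| |] Hu; simpl; auto.
        -- apply H2. intros a Ha. apply (Hu _ Ha).
        -- apply (Hu _ Hr).
    + exists PInf. split; [intros z _; destruct z; simpl; auto|].
      intros [u| |] Hu; simpl; auto.
      * apply Hb. exists u. intros a Ha. apply (Hu _ Ha).
      * apply (Hu _ Hr).
  - exists MInf. split; [|intros; simpl; auto].
    intros [a| |] Ha; simpl; auto. apply He; eauto.
Qed.

Lemma Rbar_sup_lub E : Rbar_is_lub E (Rbar_sup E).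
Proof. exact (epsilon_spec _ _ (Rbar_lub_exists E)). Qed.

Lemma Rbar_inf_glb E : Rbar_is_glb E (Rbar_inf E).
Proof.
  apply (epsilon_spec _ (Rbar_is_glb E)). destruct (Rbar_lub_exists (fun u => forall z, E z -> Rbar_le u z)) as [l [H1 H2]].
  exists l. split; auto.
Qed.

Lemma Rbar_sup_ub (E : Rbar -> Prop) z : E z -> Rbar_le z (Rbar_sup E).
Proof. apply Rbar_sup_lub. Qed.

Lemma Rbar_sup_le (E : Rbar -> Prop) u : (forall z, E z -> Rbar_le z u) -> Rbar_le (Rbar_sup E) u.
Proof. apply Rbar_sup_lub. Qed.

Lemma Rbar_inf_lb (E : Rbar -> Prop) z : E z -> Rbar_le (Rbar_inf E) z.
Proof. apply Rbar_inf_glb. Qed.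

Lemma Rbar_inf_ge (E : Rbar -> Prop) u : (forall z, E z -> Rbar_le u z) -> Rbar_le u (Rbar_inf E).
Proof. apply Rbar_inf_glb. Qed.

Lemma Rbar_inf_approx E b c : Rbar_le (Rbar_inf E) (Finite b) -> b < c ->
  exists z, E z /\ Rbar_le z (Finite c).
Proof.
  intros Hb Hc. apply NNPP. intros Hn.
  assert (H : Rbar_le (Finite c) (Rbar_inf E)).
  { apply Rbar_inf_ge. intros z Hz. destruct (Rbar_le_total (Finite c) z); auto.
    exfalso; eauto. }
  generalize (Rbar_le_trans _ _ _ H Hb). simpl. lra.
Qed.

Lemma Rbar_max_ge_r x y : Rbar_le y (Rbar_max x y).
Proof. apply Rbar_sup_ub; auto. Qed.

Lemma Rbar_max_ge_l x y : Rbar_le x (Rbar_max x y).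
Proof. apply Rbar_sup_ub; auto. Qed.

Lemma Rbar_le_epsilon x b : (forall d, 0 < d -> Rbar_le x (Finite (b + d))) -> Rbar_le x (Finite b).
Proof.
  intros H. destruct x as [a| |]; simpl; auto.
  - apply Rle_plus_epsilon. intros e He. apply (H e He).
  - apply (H 1); lra.
Qed.

Lemma limsup_0plus_le f d b : 0 < d -> (forall w, 0 < w < d -> Rbar_le (f w) b) ->
  Rbar_le (limsup_0plus f) b.
Proof.
  intros Hd H. eapply Rbar_le_trans; [apply Rbar_inf_lb; exists d; split; [auto|reflexivity]|].
  apply Rbar_sup_le. intros z (w & Hw & ->). auto.
Qed.

Lemma limsup_seq_le u N b : (forall k, (N <= k)%nat -> Rbar_le (u k) b) ->
  Rbar_le (limsup_seq u) b.
Proof.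
  intros H. eapply Rbar_le_trans; [apply Rbar_inf_lb; exists N; reflexivity|].
  apply Rbar_sup_le. intros z (w & Hw & ->). auto.
Qed.

Lemma limsup_0plus_lt f b c : Rbar_le (limsup_0plus f) (Finite b) -> b < c ->
  exists d, 0 < d /\ forall w, 0 < w < d -> Rbar_le (f w) (Finite c).
Proof.
  intros H Hc. destruct (Rbar_inf_approx _ _ _ H Hc) as (z & (d & Hd & ->) & Hz).
  exists d. split; auto. intros w Hw. eapply Rbar_le_trans; [|apply Hz].
  apply Rbar_sup_ub. exists w; auto.
Qed.

Lemma limsup_seq_lt u b c : Rbar_le (limsup_seq u) (Finite b) -> b < c ->
  exists N, forall k, (N <= k)%nat -> Rbar_le (u k) (Finite c).
Proof.
  intros H Hc. destruct (Rbar_inf_approx _ _ _ H Hc) as (z & (N & ->) & Hz).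
  exists N. intros k Hk. eapply Rbar_le_trans; [|apply Hz].
  apply Rbar_sup_ub. exists k; auto.
Qed.

Lemma Rbar_ln_mult_le x V c : Rbar_le x (Finite V) -> 0 < V -> 0 < c ->
  Rbar_le (Rbar_mult_real (Rbar_ln x) c) (Finite (ln V * c)).
Proof.
  intros Hx HV Hc.
  assert (HM : Rbar_le (Rbar_mult_real MInf c) (Finite (ln V * c))).
  { simpl. destruct (Rlt_dec 0 c); simpl; auto; lra. }
  destruct x as [r| |]; simpl in Hx; [|tauto|apply HM].
  unfold Rbar_ln. destruct (Rlt_dec 0 r) as [Hr|Hr]; [|apply HM].
  simpl. apply Rmult_le_compat_r; [lra|].
  destruct Hx as [Hx| ->]; [left; apply ln_increasing; auto | lra].
Qed.

Lemma Rbar_ln_mult_le_inv x L c : 0 < c ->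
  Rbar_le (Rbar_mult_real (Rbar_ln x) c) (Finite L) -> Rbar_le x (Finite (exp (L / c))).
Proof.
  intros Hc H. destruct x as [r| |]; simpl; auto.
  - generalize (exp_pos (L / c)); intro. unfold Rbar_ln in H.
    destruct (Rlt_dec 0 r) as [Hr|Hr]; [|lra].
    rewrite <- (exp_ln r) by auto. apply exp_mono. simpl in H.
    apply Rmult_le_reg_r with c; auto. unfold Rdiv. rewrite Rmult_assoc, Rinv_l; lra.
  - simpl in H. destruct (Rlt_dec 0 c); simpl in H; tauto.
Qed.

(** * Covering numbers and microstates *)

Lemma rmaxn_lt m f w : 0 < w -> (forall i, (i < m)%nat -> f i < w) -> rmaxn m f < w.
Proof.
  intros Hw. induction m; simpl; intros H; auto. apply Rmax_lub_lt; auto with arith.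
Qed.

(** The radius is halved because the balls in [nu_inf] are open. *)
Lemma nu_inf_le n k S w N : 0 < w ->
  covered S (fun a b : Tup => forall i, (i < n)%nat -> op_bounded k (mat_sub (a i) (b i)) (w / 2)) N ->
  Rbar_le (nu_inf n k S w) (Finite N).
Proof.
  intros Hw Hcov. destruct (covered_centers _ _ _ Hcov) as (ds & Hl & HS & Hd).
  apply Rbar_le_trans with (Finite (INR (length ds))); [|exact Hl].
  apply Rbar_inf_lb. exists ds. split; [reflexivity|]. split; auto.
  intros a Ha. destruct (Hd a Ha) as (d & Hin & Had). exists d. split; auto.
  apply rmaxn_lt; auto. intros i Hi.
  apply Rle_lt_trans with (w / 2); [|lra]. apply op_norm_le; [lra|auto].
Qed.

Lemma tup_dist2_component n k A B w i : (1 <= k)%nat -> (i < n)%nat -> 0 < w ->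
  tup_dist2 n k A B < w -> fnorm k (mat_sub (A i) (B i)) <= sqrt (INR k) * w.
Proof.
  intros Hk Hi Hw H.
  assert (Hki : 0 < INR k) by (apply lt_0_INR; lia).
  assert (E : forall D, CRe (tau k (mat_mul k (mat_adj D) D)) = fnorm k D ^ 2 / INR k).
  { intros D. unfold tau. cbn [CRe]. f_equal. rewrite fnorm_sq. apply rsum_ext; intros j _.
    unfold mat_mul. rewrite CRe_csum. apply rsum_ext; intros l _. rewrite Cmod_sq.
    unfold mat_adj. simpl. ring. }
  assert (Hnn : forall D, 0 <= CRe (tau k (mat_mul k (mat_adj D) D))).
  { intros D. rewrite E. apply Rmult_le_pos; [apply pow2_ge_0|].
    left; apply Rinv_0_lt_compat; auto. }
  assert (Ht := rsum_term_le n (fun i => CRe (tau k (mat_mul k (mat_adj (mat_sub (A i) (B i)))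
     (mat_sub (A i) (B i))))) i (fun j _ => Hnn _) Hi).
  cbv beta in Ht. rewrite E in Ht.
  assert (Hs : tup_dist2 n k A B ^ 2 < w ^ 2).
  { assert (0 <= tup_dist2 n k A B) by apply sqrt_pos. nra. }
  unfold tup_dist2 in Hs. rewrite pow2_sqrt in Hs by (apply rsum_nonneg; intros; apply Hnn).
  cbv zeta in Hs.
  assert (Hlt : fnorm k (mat_sub (A i) (B i)) ^ 2 / INR k <= w ^ 2) by lra.
  apply sq_le_inv; [apply Rmult_le_pos; [apply sqrt_pos|lra]|].
  rewrite Rpow_mult_distr, pow2_sqrt by lra.
  apply Rmult_le_reg_r with (/ INR k); [apply Rinv_0_lt_compat; auto|].
  replace (INR k * w ^ 2 * / INR k) with (w ^ 2) by (field; lra). exact Hlt.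
Qed.

Lemma unitary_on_mat_conj_le k W D : unitary_on k W -> fnorm k (mat_conj k W D) <= fnorm k D.
Proof.
  intros HW. unfold mat_conj.
  eapply Rle_trans; [apply fnorm_mul_r with (c := 1); [lra|apply unitary_on_op_bounded, unitary_on_adj; auto]|].
  rewrite Rmult_1_l. eapply Rle_trans; [apply fnorm_mul_l with (c := 1); [lra|apply unitary_on_op_bounded; auto]|].
  lra.
Qed.

Lemma mat_conj_sub k W A B : mat_sub (mat_conj k W A) (mat_conj k W B) = mat_conj k W (mat_sub A B).
Proof. unfold mat_conj. rewrite mat_mul_sub_r, mat_mul_sub_l. reflexivity. Qed.

(** Undoing [W2] brings [b] close to the common centre [c], and [W1] then brings it close to [a];
    conjugation does not increase the norm. *)
Lemma orbit_compare k W1 W2 a b c : unitary_on k W1 -> unitary_on k W2 ->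
  fnorm k (mat_sub a (mat_conj k (mat_mul k W1 (mat_adj W2)) b))
  <= fnorm k (mat_sub a (mat_conj k W1 c)) + fnorm k (mat_sub b (mat_conj k W2 c)).
Proof.
  intros H1 H2.
  assert (E : mat_conj k (mat_mul k W1 (mat_adj W2)) b = mat_conj k W1 (mat_conj k (mat_adj W2) b)).
  { unfold mat_conj. rewrite mat_adj_mul, !mat_mul_assoc. reflexivity. }
  rewrite E.
  replace (mat_sub a (mat_conj k W1 (mat_conj k (mat_adj W2) b))) with
    (mat_add (mat_sub a (mat_conj k W1 c)) (mat_sub (mat_conj k W1 c) (mat_conj k W1 (mat_conj k (mat_adj W2) b)))).
  2:{ extensionality i; extensionality j. unfold mat_add, mat_sub. cring. }
  eapply Rle_trans; [apply fnorm_add|]. apply Rplus_le_compat_l.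
  rewrite mat_conj_sub. eapply Rle_trans; [apply unitary_on_mat_conj_le; auto|].
  rewrite (fnorm_sub_comm k b).
  rewrite (fnorm_ext k _ (mat_conj k (mat_adj W2) (mat_sub (mat_conj k W2 c) b))).
  - apply unitary_on_mat_conj_le, unitary_on_adj; auto.
  - rewrite <- mat_conj_sub. intros i j Hi Hj. unfold mat_sub. f_equal.
    symmetry. destruct H2 as [_ H2]. unfold mat_conj. rewrite !mat_adj_adj, !mat_mul_assoc.
    rewrite (cancel_inner k _ _ _ H2) by auto.
    rewrite (mat_eqk_mul k c c _ _ (mat_eqk_refl k c) H2) by auto.
    apply mat_mul_1_r; auto.
Qed.

Lemma orbit_balls_covered n k w S (cs : list Tup) : (1 <= k)%nat -> 0 < w ->
  (forall a, S a -> exists c, In c cs /\ orbit_ball n k c w a) ->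
  covered S (fun a b => exists W, unitary_on k W /\ forall i, (i < n)%nat ->
    fnorm k (mat_sub (a i) (mat_conj k W (b i))) <= sqrt (INR k) * (2 * w)) (INR (length cs)).
Proof.
  intros Hk Hw H. exists (map (fun c => orbit_ball n k c w) cs). rewrite length_map.
  split; [lra|]. split.
  - intros a Ha. destruct (H a Ha) as (c & Hin & Hc). exists (orbit_ball n k c w).
    split; auto. apply in_map_iff; eauto.
  - intros p a b Hp _ _ Ha Hb. apply in_map_iff in Hp. destruct Hp as (c & <- & _).
    destruct Ha as (W1 & (_ & HW1) & Ha), Hb as (W2 & (_ & HW2) & Hb).
    exists (mat_mul k W1 (mat_adj W2)). split; [apply unitary_on_mul; auto; apply unitary_on_adj; auto|].
    intros i Hi. eapply Rle_trans; [apply (orbit_compare k W1 W2 _ _ (c i)); auto|].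
    generalize (tup_dist2_component n k _ _ w i Hk Hi Hw Ha)
      (tup_dist2_component n k _ _ w i Hk Hi Hw Hb).
    unfold tup_conj, mat_conj. lra.
Qed.

(* As the coordinate polynomials occur in the enumeration, microstates are
   norm-bounded independently of the cutoff [Rr]. *)
Lemma microstates_bounded (A : CStarAlgebra) (n : nat) (x : nat -> A) (P : nat -> ncpoly)
  (HPenum : forall p, vars_lt n p -> exists r, P r = p) :
  exists R0 r0, 0 < R0 /\ forall Rr k eps r T, Gamma_top A n x P Rr k eps r T ->
    eps <= 1 -> (r0 <= r)%nat -> forall i, (i < n)%nat -> op_bounded k (T i) R0.
Proof.
  assert (H : forall m, (m <= n)%nat -> exists R0 r0, 0 < R0 /\ forall Rr k eps r T,
    Gamma_top A n x P Rr k eps r T -> eps <= 1 -> (r0 <= r)%nat ->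
    forall i, (i < m)%nat -> op_bounded k (T i) R0).
  { induction m; intros Hm.
    - exists 1, 0%nat. split; [lra|]. intros; lia.
    - destruct (IHm ltac:(lia)) as (R0 & r0 & HR0 & H).
      destruct (HPenum (NCvar m)) as [j Hj]; [exact Hm|].
      exists (R0 + cnorm A (x m) + 1), (r0 + S j)%nat.
      assert (Hn := cnorm_nonneg A (x m)).
      split; [lra|]. intros Rr k eps r T HT Heps Hr i Hi.
      destruct (Nat.eq_dec i m) as [->|Hne].
      + destruct HT as (_ & _ & HT). specialize (HT j ltac:(lia)). rewrite Hj in HT. simpl in HT.
        eapply op_bounded_le; [|apply op_bounded_op_norm].
        unfold Rabs in HT; destruct Rcase_abs; lra.
      + eapply op_bounded_le; [|eapply H; eauto; lia]. lra. }
  destruct (H n (Nat.le_refl n)) as (R0 & r0 & HR0 & Hb). eauto.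
Qed.

Lemma Gamma_top_mono A n x P Rr k eps eps' r r' T : eps' <= eps -> (r <= r')%nat ->
  Gamma_top A n x P Rr k eps' r' T -> Gamma_top A n x P Rr k eps r T.
Proof.
  intros He Hr (H1 & H2 & H3). split; [auto|]. split; [auto|].
  intros j Hj. eapply Rle_trans; [apply H3; lia|auto].
Qed.

(** The infimum in [o2] is approached by an actual cover, at the price of the [+ 1]. *)
Lemma o2_cover n k S w L : (1 <= k)%nat ->
  Rbar_le (Rbar_mult_real (Rbar_ln (o2 n k S w)) (/ (INR k ^ 2))) (Finite L) ->
  exists cs : list Tup, INR (length cs) <= exp (L * INR k ^ 2) + 1 /\
    forall a, S a -> exists c, In c cs /\ orbit_ball n k c w a.
Proof.
  intros Hk H.
  assert (Hk2 : 0 < INR k ^ 2) by (apply pow_lt, lt_0_INR; lia).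
  apply Rbar_ln_mult_le_inv in H; [|apply Rinv_0_lt_compat; auto].
  unfold Rdiv in H. rewrite Rinv_inv in H.
  destruct (Rbar_inf_approx _ _ (exp (L * INR k ^ 2) + 1) H ltac:(lra))
    as (z & (cs & -> & _ & Hcs) & Hz).
  exists cs. split; auto.
Qed.

Lemma delta_top_le_1 (A : CStarAlgebra) (n : nat) (x : nat -> A) (P : nat -> ncpoly)
  (HPenum : forall p, vars_lt n p -> exists r, P r = p) b :
  Rbar_le (K2_top A n x P) (Finite b) -> Rbar_le (delta_top A n x P) (Finite 1).
Proof.
  intros HK. destruct (limsup_0plus_lt _ _ (Rabs b + 1) HK) as (d & Hd & HKw).
  { generalize (Rle_abs b); lra. }
  (* One unit is lost in each of three infima: the limsup over the radius, the infimum over [eps]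
     and [r], the limsup over [k]. *)
  set (L := Rabs b + 1 + 1 + 1). assert (HL : 0 <= L) by (unfold L; generalize (Rabs_pos b); lra).
  destruct (microstates_bounded A n x P HPenum) as (R0 & r0 & HR0 & Hbdd).
  destruct (orbit_covered n R0 HR0) as (Cg & HCg & Hcov).
  (* The part of (log nu) / k^2 that does not grow as w tends to 0: [L + 1] bounds the orbit count
     together with its [+ 1], and 2 Cg^2 / w equals [Cg / w0] for the radius [w0] below. *)
  set (c0 := L + 1 + ln (2 * Cg ^ 2)).
  apply Rbar_le_epsilon. intros e He.
  (* Below the last bound c0 / (- ln w) is at most [e]. The cutoff [Rr] is introduced only after
     this choice. *)
  set (d' := Rmin (Rmin 1 d) (exp (- c0 / e))).
  assert (Hd' : 0 < d') by (repeat apply Rmin_glb_lt; try lra; apply exp_pos).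
  apply limsup_0plus_le with d'; auto. intros w Hw.
  assert (Hw1 : w < 1 /\ w < d /\ w < exp (- c0 / e)).
  { unfold d' in Hw. generalize (Rmin_l (Rmin 1 d) (exp (- c0 / e)))
      (Rmin_r (Rmin 1 d) (exp (- c0 / e))) (Rmin_l 1 d) (Rmin_r 1 d). lra. }
  destruct Hw1 as (Hw1 & Hwd & Hwe).
  (* Orbit balls of this radius lead to pieces of operator norm diameter Cg w0 = w / 2, as
     [nu_inf_le] requires. *)
  set (w0 := w / (2 * Cg)).
  assert (Hi : 0 < / (2 * Cg) <= 1).
  { split; [apply Rinv_0_lt_compat; lra|]. rewrite <- Rinv_1. apply Rinv_le_contravar; lra. }
  assert (Hw0 : 0 < w0 <= w) by (unfold w0, Rdiv; nra).
  apply Rbar_sup_le. intros z (Rr & HRr & ->).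
  assert (Hex : exists eps r N, 0 < eps /\ forall k, (N <= k)%nat ->
    Rbar_le (Rbar_mult_real (Rbar_ln (o2 n k (Gamma_top A n x P Rr k eps r) w0)) (/ (INR k ^ 2)))
      (Finite L)).
  { assert (H1 : Rbar_le (inf_eps_r (fun eps r => limsup_seq (fun k => Rbar_mult_real
      (Rbar_ln (o2 n k (Gamma_top A n x P Rr k eps r) w0)) (/ (INR k ^ 2))))) (Finite (Rabs b + 1))).
    { eapply Rbar_le_trans; [|apply (HKw w0); lra]. apply Rbar_sup_ub. exists Rr; auto. }
    destruct (Rbar_inf_approx _ _ (Rabs b + 1 + 1) H1 ltac:(lra)) as (z & (eps & r & Heps & ->) & Hz).
    destruct (limsup_seq_lt _ _ L Hz ltac:(unfold L; lra)) as (N & HN).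
    exists eps, r, N. auto. }
  destruct Hex as (eps & r & N & Heps & HN).
  (* Tightening the constraints makes the microstates bounded by [R0] and keeps them inside the set
     already covered by orbit balls. *)
  set (eps' := Rmin eps 1). set (r' := Nat.max r r0).
  eapply Rbar_le_trans.
  { apply Rbar_inf_lb. exists eps', r'. split; [|reflexivity]. apply Rmin_glb_lt; lra. }
  apply limsup_seq_le with (Nat.max N 1). intros k Hk.
  assert (Hk1 : (1 <= k)%nat) by lia.
  assert (HkR : 1 <= INR k) by (apply (le_INR 1); auto).
  destruct (o2_cover n k _ w0 L Hk1 (HN k ltac:(lia))) as (cs & Hl & Hcs).
  assert (Hnu : Rbar_le (nu_inf n k (Gamma_top A n x P Rr k eps' r') w)
                  (Finite (INR (length cs) * (Cg / w0) ^ (k * k)))).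
  { apply nu_inf_le; [lra|].
    replace (w / 2) with (Cg * w0) by (unfold w0; field; lra).
    apply Hcov; auto; [lra| |].
    - intros a Ha i Hin. eapply Hbdd; eauto; [apply Rmin_r | unfold r'; lia].
    - apply orbit_balls_covered; [auto|lra|]. intros a Ha. apply Hcs.
      eapply Gamma_top_mono; [| |apply Ha]; [apply Rmin_l | unfold r'; lia]. }
  assert (Hlnw : ln w < 0) by (rewrite <- ln_1; apply ln_increasing; lra).
  assert (Hlnw' : e * ln w <= - c0).
  { assert (ln w < - c0 / e) by (rewrite <- (ln_exp (- c0 / e)); apply ln_increasing; lra).
    replace (- c0) with (e * (- c0 / e)) by (field; lra). apply Rmult_le_compat_l; lra. }
  assert (Hk2 : 0 < INR k ^ 2) by (apply pow_lt; lra).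
  assert (Hpos : 0 < 2 * Cg ^ 2 / w).
  { apply Rdiv_lt_0_compat; [|lra]. assert (0 < Cg ^ 2) by (apply pow_lt; lra). lra. }
  set (V := exp ((L + 1) * INR k ^ 2) * (2 * Cg ^ 2 / w) ^ (k * k)).
  assert (HV : INR (length cs) * (Cg / w0) ^ (k * k) <= V).
  { unfold V. replace (Cg / w0) with (2 * Cg ^ 2 / w) by (unfold w0; field; lra).
    apply Rmult_le_compat_r; [apply pow_le; lra|].
    eapply Rle_trans; [apply Hl|].
    rewrite Rmult_plus_distr_r, exp_plus, Rmult_1_l.
    (* The [+ 1] is absorbed: exp(L k^2) + 1 <= 2 exp(L k^2) <= exp(k^2) exp(L k^2), using k >=
       1. *)
    assert (1 <= exp (L * INR k ^ 2)) by (rewrite <- exp_0; apply exp_mono; nra).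
    assert (2 <= exp (INR k ^ 2)) by (generalize (exp_ineq1_le (INR k ^ 2)); nra).
    nra. }
  eapply Rbar_le_trans.
  { apply Rbar_ln_mult_le with (V := V).
    - eapply Rbar_le_trans; [apply Hnu|exact HV].
    - unfold V. apply Rmult_lt_0_compat; [apply exp_pos | apply pow_lt; auto].
    - apply Rinv_0_lt_compat. nra. }
  assert (HlnV : ln V = INR k ^ 2 * (c0 - ln w)).
  { unfold V, c0. rewrite ln_mult, ln_exp, ln_pow, mult_INR; auto; [| apply exp_pos | apply pow_lt; auto].
    unfold Rdiv. rewrite ln_mult, ln_Rinv; [ring|lra| |apply Rinv_0_lt_compat; lra].
    assert (0 < Cg ^ 2) by (apply pow_lt; lra). lra. }
  rewrite HlnV. cbn [Rbar_le].
  replace (INR k ^ 2 * (c0 - ln w) * / (- (INR k ^ 2) * ln w)) with (1 + c0 / - ln w)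
    by (field; split; [lra|nra]).
  apply Rplus_le_compat_l. apply Rmult_le_reg_r with (- ln w); [lra|].
  unfold Rdiv. rewrite Rmult_assoc, Rinv_l by lra. lra.
Qed.

Theorem theorem3p1 (A : CStarAlgebra) (n : nat) (x : nat -> A) (P : nat -> ncpoly)
  (Hsa : forall i, (i < n)%nat -> cstar A (x i) = x i)
  (HPvars : forall r, vars_lt n (P r))
  (HPenum : forall p, vars_lt n p -> exists r, P r = p) :
  Rbar_le (delta_top A n x P) (Rbar_max (K2_top A n x P) (Finite 1)) /\
  (K2_top A n x P = Finite 0 -> Rbar_le (delta_top A n x P) (Finite 1)).
Proof.
  split.
  (* Any real upper bound for the orbit dimension, including when it is -infinity, already yields
     the bound 1; otherwise the maximum is +infinity. *)
  - destruct (classic (exists b, Rbar_le (K2_top A n x P) (Finite b))) as [[b Hb]|Hn].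
    + eapply Rbar_le_trans; [apply (delta_top_le_1 A n x P HPenum b Hb) | apply Rbar_max_ge_r].
    + eapply Rbar_le_trans; [|apply Rbar_max_ge_l].
      destruct (K2_top A n x P) as [r| |].
      * exfalso. apply Hn. exists r. apply Rbar_le_refl.
      * destruct (delta_top A n x P); simpl; auto.
      * exfalso. apply Hn. exists 0. exact I.
  - intros H0. apply (delta_top_le_1 A n x P HPenum 0). rewrite H0. apply Rbar_le_refl.
Qed.
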